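(* Let $H$ be a Fréchet–Hilbert space, $u\colon\mathcal{S}\to H$ a continuous linear map and $k,n\in\mathbb{N}$. Then there exist $(2n+1)$-states $\phi_1,\phi_2$ on $\mathcal{S}$ such that for all $x\in\mathcal{S}$, \[\|ux\|_k\leqslant\sqrt{K}\,\|u\|_{n,k}\big(\phi_1(x^*x)+\phi_2(xx^* )\big)^{1/2}.\]
   Context: Let $\mathbb{N}=\{1,2,\dots\}$. Let $s$ be the space of complex sequences $\xi=(\xi_j)_{j\geqslant1}$ with $|\xi|_n:=(\sum_{j}|\xi_j|^2j^{2n})^{1/2}<\infty$ for all $n\in\mathbb{N}$, and let $s'$ be its dual, the space of sequences $\eta$ with $|\eta|_n':=(\sum_j|\eta_j|^2j^{-2n})^{1/2}<\infty$ for some $n$, with pairing $\langle\xi,\eta\rangle=\sum_j\xi_j\overline{\eta_j}$. The noncommutative Schwartz space $\mathcal{S}=L(s',s)$ is the Fréchet space of continuous linear operators $s'\to s$ with the topology of uniform convergence on bounded sets; it is a $*$-algebra with product $xy:=x\circ\iota\circ y$ ($\iota\colon s\hookrightarrow s'$ the inclusion) and involution given by $\langle x^*\xi,\eta\rangle=\langle\xi,x\eta\rangle$; $\mathcal{S}'$ is its dual. For $n\in\mathbb{N}$, $\|x\|_n:=\sup\{|x\xi|_n\colon \xi\in s',\ |\xi|_n'\leqslant1\}$, and $\|u\|_n^*:=\sup\{|u(x,y)|\colon\|x\|_n\leqslant1,\|y\|_n\leqslant1\}$ for bilinear $u$. For $x_1,\dots,x_m\in\mathcal{S}$, $\|(x_j)\|_k^{rc}:=\max\{\|\sum_jx_j^*x_j\|_k^{1/2},\|\sum_jx_jx_j^*\|_k^{1/2}\}$.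 A Fréchet–Hilbert space $H$ is a Fréchet space whose topology is given by a non-decreasing sequence of seminorms $\|\cdot\|_k$ induced by semi-inner products. For a linear map $T\colon\mathcal{S}\to H$, $\|T\|_{n,k}:=\sup\{\|Tx\|_k\colon\|x\|_n\leqslant1\}$. For $\xi\in s'$ with $|\xi|_n'\leqslant1$ let $\phi_\xi(x)=\langle x\xi,\xi\rangle$; an $n$-state on $\mathcal{S}$ is an element of the closed convex hull in $\mathcal{S}'$ of $\{\phi_\xi\colon |\xi|_n'\leqslant1\}$. For $n\in\mathbb{N}$, $K_n$ denotes the smallest constant such that $|\sum_{j=1}^mu(x_j,y_j)|\leqslant K_n\|u\|_n^*\|(x_j)\|_{2n+1}^{rc}\|(y_j)\|_{2n+1}^{rc}$ for all continuous bilinear forms $u$ on $\mathcal{S}\times\mathcal{S}$, all $m$ and all $x_j,y_j\in\mathcal{S}$; and $K:=\sup_nK_n$ (which satisfies $K\leqslant\pi^2/6$). *)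

(* Defs.v *)
From Stdlib Require Import Reals List ClassicalEpsilon.
From Coquelicot Require Import Coquelicot.
Open Scope R_scope.

Definition Rbar_sqrt (x : Rbar) : Rbar :=
  match x with Finite r => Finite (sqrt r) | p_infty => p_infty | m_infty => Finite 0 end.
Definition Rbar_maxi (x y : Rbar) : Rbar := if Rbar_le_dec x y then y else x.

(** * Sequence spaces s and s'.  A sequence (xi_j)_{j>=1} is represented by
    [xi : nat -> C] with xi_j = xi (j-1); the weight j^{2n} becomes (INR (i+1))^(2n). *)
Definition cseq := nat -> C.

Definition esum (a : nat -> R) : Rbar := Lim_seq (sum_n a).

Definition sqnorm_s (n : nat) (xi : cseq) : Rbar :=
  esum (fun i => (Cmod (xi i))^2 * (INR (S i))^(2*n)).
Definition sqnorm_s' (n : nat) (xi : cseq) : Rbar :=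
  esum (fun i => (Cmod (xi i))^2 / (INR (S i))^(2*n)).

Definition in_s (xi : cseq) : Prop := forall n : nat, (1 <= n)%nat -> is_finite (sqnorm_s n xi).
Definition in_s' (xi : cseq) : Prop := exists n : nat, (1 <= n)%nat /\ is_finite (sqnorm_s' n xi).

Definition ball_s' (n : nat) (xi : cseq) : Prop := Rbar_le (sqnorm_s' n xi) (Finite 1).

Definition CSeries (a : nat -> C) : C := (Series (fun i => Re (a i)), Series (fun i => Im (a i))).

Definition pairing (xi eta : cseq) : C := CSeries (fun i => (xi i * Cconj (eta i))%C).

(** * Operators: raw maps s' -> s (acting on all sequences; only values on s' matter) *)
Definition op := cseq -> cseq.

Definition opnorm (n : nat) (x : op) : Rbar :=
  Lub_Rbar (fun r => exists xi, ball_s' n xi /\ Rbar_le (Finite r) (Rbar_sqrt (sqnorm_s n (x xi)))).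

(** x is an element of the noncommutative Schwartz space S = L(s', s):
    a linear map s' -> s, continuous, i.e. all seminorms ||x||_n are finite
    (these seminorms define the topology of S = L(s',s)). *)
Definition in_S (x : op) : Prop :=
  (forall xi, in_s' xi -> in_s (x xi)) /\
  (forall (a : C) xi eta, in_s' xi -> in_s' eta ->
      forall i, x (fun j => a * xi j + eta j)%C i = (a * x xi i + x eta i)%C) /\
  (forall n : nat, (1 <= n)%nat -> is_finite (opnorm n x)).

(** product xy = x o iota o y *)
Definition opmul (x y : op) : op := fun xi => x (y xi).
Definition opadd (x y : op) : op := fun xi i => (x xi i + y xi i)%C.
Definition opscal (a : C) (x : op) : op := fun xi i => (a * x xi i)%C.
Definition opzero : op := fun _ _ => 0%C.
Definition opsum (l : list op) : op := fold_right opadd opzero l.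

Definition is_adjoint (x y : op) : Prop :=
  in_S y /\ forall xi eta, in_s' xi -> in_s' eta -> pairing (y xi) eta = pairing xi (x eta).

(** the involution x* (the unique adjoint; chosen by description) *)
Definition star (x : op) : op :=
  epsilon (inhabits opzero) (is_adjoint x).

Definition lin_S (phi : op -> C) : Prop :=
  forall (a : C) x y, in_S x -> in_S y -> phi (opadd (opscal a x) y) = (a * phi x + phi y)%C.
Definition cont_S (phi : op -> C) : Prop :=
  exists (m : nat) (c : R), (1 <= m)%nat /\
    forall x, in_S x -> Rbar_le (Finite (Cmod (phi x))) (Rbar_mult (Finite c) (opnorm m x)).

Definition phi_vec (xi : cseq) : op -> C := fun x => pairing (x xi) xi.

Definition convcomb (l : list (R * cseq)) (x : op) : C :=
  fold_right (fun p acc => (RtoC (fst p) * phi_vec (snd p) x + acc)%C) 0%C l.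

(** phi is an n-state: an element of S' lying in the (weak-star) closure of the
    convex hull of { phi_xi : |xi|_n' <= 1 }. *)
Definition is_state (n : nat) (phi : op -> C) : Prop :=
  lin_S phi /\ cont_S phi /\
  forall (xs : list op) (eps : R), (forall x, In x xs -> in_S x) -> 0 < eps ->
    exists l : list (R * cseq),
      (forall p, In p l -> 0 <= fst p /\ ball_s' n (snd p)) /\
      fold_right (fun p acc => fst p + acc) 0 l = 1 /\
      (forall x, In x xs -> Cmod (phi x - convcomb l x)%C < eps).

Definition bilin_S (u : op -> op -> C) : Prop :=
  (forall (a : C) x1 x2 y, in_S x1 -> in_S x2 -> in_S y ->
     u (opadd (opscal a x1) x2) y = (a * u x1 y + u x2 y)%C) /\
  (forall (a : C) x y1 y2, in_S x -> in_S y1 -> in_S y2 ->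
     u x (opadd (opscal a y1) y2) = (a * u x y1 + u x y2)%C).
Definition cont_bilin_S (u : op -> op -> C) : Prop :=
  exists (m : nat) (c : R), (1 <= m)%nat /\
    forall x y, in_S x -> in_S y ->
      Rbar_le (Finite (Cmod (u x y))) (Rbar_mult (Finite c) (Rbar_mult (opnorm m x) (opnorm m y))).

Definition bilnorm (n : nat) (u : op -> op -> C) : Rbar :=
  Lub_Rbar (fun r => exists x y, in_S x /\ in_S y /\
     Rbar_le (opnorm n x) (Finite 1) /\ Rbar_le (opnorm n y) (Finite 1) /\ r <= Cmod (u x y)).

Definition rcnorm (k : nat) (xs : list op) : Rbar :=
  Rbar_maxi (Rbar_sqrt (opnorm k (opsum (map (fun x => opmul (star x) x) xs))))
            (Rbar_sqrt (opnorm k (opsum (map (fun x => opmul x (star x)) xs)))).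

Definition Csum (l : list C) : C := fold_right Cplus 0%C l.

Definition Kconst_n (n : nat) : Rbar :=
  Glb_Rbar (fun c => 0 <= c /\
    forall u : op -> op -> C, bilin_S u -> cont_bilin_S u ->
    forall ps : list (op * op), (forall p, In p ps -> in_S (fst p) /\ in_S (snd p)) ->
      Rbar_le (Finite (Cmod (Csum (map (fun p => u (fst p) (snd p)) ps))))
        (Rbar_mult (Finite c) (Rbar_mult (bilnorm n u)
            (Rbar_mult (rcnorm (2*n+1) (map fst ps)) (rcnorm (2*n+1) (map snd ps)))))).

Definition Kconst : Rbar :=
  Lub_Rbar (fun r => exists n : nat, (1 <= n)%nat /\ Rbar_le (Finite r) (Kconst_n n)).

Record FrechetHilbert := {
  FH_car :> ModuleSpace C_Ring;
  FH_ip : nat -> FH_car -> FH_car -> C;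
  FH_ip_lin : forall k (a : C) h1 h2 g,
      FH_ip k (plus (scal a h1) h2) g = (a * FH_ip k h1 g + FH_ip k h2 g)%C;
  FH_ip_herm : forall k h g, FH_ip k g h = Cconj (FH_ip k h g);
  FH_ip_pos : forall k h, 0 <= Re (FH_ip k h h);
  FH_mono : forall k h, Re (FH_ip k h h) <= Re (FH_ip (S k) h h);
  FH_sep : forall h, (forall k, Re (FH_ip k h h) = 0) -> h = zero;
  FH_complete : forall hs : nat -> FH_car,
      (forall k eps, 0 < eps -> exists N, forall p q, (N <= p)%nat -> (N <= q)%nat ->
          sqrt (Re (FH_ip k (minus (hs p) (hs q)) (minus (hs p) (hs q)))) < eps) ->
      exists h, forall k eps, 0 < eps -> exists N, forall p, (N <= p)%nat ->
          sqrt (Re (FH_ip k (minus (hs p) h) (minus (hs p) h))) < eps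
}.

Definition FH_norm (H : FrechetHilbert) (k : nat) (h : H) : R := sqrt (Re (FH_ip H k h h)).

Definition lin_map (H : FrechetHilbert) (u : op -> H) : Prop :=
  forall (a : C) x y, in_S x -> in_S y -> u (opadd (opscal a x) y) = plus (scal a (u x)) (u y).
Definition cont_map (H : FrechetHilbert) (u : op -> H) : Prop :=
  forall k : nat, exists (m : nat) (c : R), (1 <= m)%nat /\
    forall x, in_S x -> Rbar_le (Finite (FH_norm H k (u x))) (Rbar_mult (Finite c) (opnorm m x)).

Definition mapnorm (H : FrechetHilbert) (n k : nat) (u : op -> H) : Rbar :=
  Lub_Rbar (fun r => exists x, in_S x /\ Rbar_le (opnorm n x) (Finite 1) /\ r <= FH_norm H k (u x)).

(* Main.v *)
Require Import Defs.
From Stdlib Require Import Arith Reals Lra Lia Psatz List.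
From Stdlib Require Import Classical ClassicalEpsilon FunctionalExtensionality.
From Coquelicot Require Import Coquelicot.
From mathcomp Require filter.
Open Scope R_scope.

(** Put C = K ||u||_{n,k}^2.  The inequality defining K, applied to the form
    (x, y) |-> <u x, u y*>_k and the pairs (x_j, x_j^* ), bounds sum_j ||u x_j||_k^2 by
    C max(||sum_j x_j^* x_j||, ||sum_j x_j x_j^*||), the norms being those of index 2n+1.
    A positive operator attains its norm on the diagonal, so for finitely many x_j and weights
    there are vectors xi, eta in the unit ball at which the weighted sum of
    C (<x_j^* x_j xi, xi> + <x_j x_j^* eta, eta>) - ||u x_j||_k^2 is almost nonnegative.
    A finite minimax principle turns this into a pair of convex combinations of vector states
    that works for all the x_j at once up to epsilon, and an ultrafilter limit over the finite
    subsets of S gives the two states.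

    When K or ||u||_{n,k} is infinite, the right-hand side is infinite as soon as
    phi_1(x^* x) + phi_2(x x^* ) > 0, and a faithful state makes this hold for every nonzero x. *)

(** The index 2n+1 comes from the definition of K alone; all other estimates hold at any index p >=
    1. Two states appear because the maximum in ||.||^rc compares two independent suprema, one over
    xi and one over eta; each is at most the supremum of the sum, as the other term is nonnegative.
    Treating finitely many x_j at a time reduces the choice of the states to a problem with finitely
    many real constraints, which a descent argument settles. The ultrafilter limit then plays the
    role of weak-star compactness: on the unit ball of |.|_p' one has |phi_xi(x)| <= ||x||_p, so for
    each x the scalars stay bounded, and the same bound makes the limit functional continuous. A
    recurring obstacle is that elements of S are functions on all sequences while only their values
    on s' have meaning. Identities such as x** = x therefore hold up to [op_eq], and u has to be
    shown to respect that relation. Likewise infinite sums are total functions in the code, so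
    linearity of the pairing always rests on absolute convergence, supplied by a weighted
    Cauchy-Schwarz inequality. *)

(** * Weighted sums and membership in s and s' *)

Definition wt (n i : nat) : R := INR (S i) ^ (2 * n).
Definition wt' (n i : nat) : R := / wt n i.

(** Bounding every partial sum keeps weighted l2 estimates inside the reals, with no convergence to
    check; [esum_le] translates to and from [esum]. Note that A bounds the square of the norm. *)
Definition bnd (w : nat -> R) (xi : cseq) (A : R) : Prop :=
  forall N, sum_n (fun i => Cmod (xi i) ^ 2 * w i) N <= A.

(** [sum_n] leaves equalities typed in the carrier of an abstract monoid, whereas [ring] has to see
    [R]. *)
Local Ltac rring := match goal with |- @eq _ ?a ?b => change (@eq R a b) end; ring.

Lemma sum_n_R_S (a : nat -> R) N : sum_n a (S N) = sum_n a N + a (S N).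
Proof. rewrite sum_Sn. reflexivity. Qed.

Lemma sum_n_R_O (a : nat -> R) : sum_n a 0 = a O.
Proof. apply sum_O. Qed.

Lemma sum_n_R_ext (a b : nat -> R) N :
  (forall i, a i = b i) -> sum_n a N = sum_n b N.
Proof. intros H. apply sum_n_ext. exact H. Qed.

Lemma sum_n_R_pos (a : nat -> R) N : (forall i, 0 <= a i) -> 0 <= sum_n a N.
Proof.
  intros Ha. induction N as [|N IH].
  - rewrite sum_n_R_O. apply Ha.
  - rewrite sum_n_R_S. specialize (Ha (S N)). lra.
Qed.

Lemma sum_n_R_le (a b : nat -> R) N : (forall i, a i <= b i) -> sum_n a N <= sum_n b N.
Proof.
  intros Hab. induction N as [|N IH].
  - rewrite !sum_n_R_O. apply Hab.
  - rewrite !sum_n_R_S. specialize (Hab (S N)). lra.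
Qed.

Lemma sum_n_R_lin (c d : R) (a b : nat -> R) N :
  sum_n (fun i => c * a i + d * b i) N = c * sum_n a N + d * sum_n b N.
Proof.
  induction N as [|N IH].
  - rewrite !sum_n_R_O. reflexivity.
  - rewrite !sum_n_R_S. rewrite IH. rring.
Qed.

Lemma sum_n_R_mono (a : nat -> R) N M :
  (forall i, 0 <= a i) -> (N <= M)%nat -> sum_n a N <= sum_n a M.
Proof.
  intros Ha H. induction H as [|M H IH].
  - apply Rle_refl.
  - rewrite sum_n_R_S. specialize (Ha (S M)). lra.
Qed.

Lemma sum_n_R_ext_loc (a b : nat -> R) N :
  (forall i, (i <= N)%nat -> a i = b i) -> sum_n a N = sum_n b N.
Proof. intros H. apply sum_n_ext_loc. exact H. Qed.

Lemma term_le_sum_n (a : nat -> R) i N :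
  (forall j, 0 <= a j) -> (i <= N)%nat -> a i <= sum_n a N.
Proof.
  intros Ha Hi. apply Rle_trans with (sum_n a i).
  - destruct i as [|i].
    + rewrite sum_n_R_O. lra.
    + rewrite sum_n_R_S. pose proof (sum_n_R_pos a i Ha). lra.
  - apply sum_n_R_mono; assumption.
Qed.

(** [Lim_seq] is total and monotone, so comparing the partial sums with constant sequences gives
    both directions. *)
Lemma esum_le (a : nat -> R) (A : R) :
  (forall i, 0 <= a i) -> Rbar_le (esum a) (Finite A) <-> (forall N, sum_n a N <= A).
Proof.
  intros Ha. split; intros H.
  - intros N. change (Rbar_le (Finite (sum_n a N)) (Finite A)).
    apply Rbar_le_trans with (2 := H). unfold esum.
    rewrite <- (Lim_seq_const (sum_n a N)). apply Lim_seq_le_loc.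
    exists N. intros m Hm. apply sum_n_R_mono; assumption.
  - unfold esum. rewrite <- (Lim_seq_const A). apply Lim_seq_le_loc.
    exists O. intros m _. apply H.
Qed.

Lemma esum_pos (a : nat -> R) : (forall i, 0 <= a i) -> Rbar_le (Finite 0) (esum a).
Proof.
  intros Ha. unfold esum. rewrite <- (Lim_seq_const 0). apply Lim_seq_le_loc.
  exists O. intros m _. apply sum_n_R_pos; assumption.
Qed.

Lemma esum_finite (a : nat -> R) :
  (forall i, 0 <= a i) -> is_finite (esum a) <-> exists A, forall N, sum_n a N <= A.
Proof.
  intros Ha. split.
  - intros H. exists (real (esum a)). apply esum_le; [assumption|].
    rewrite H. apply Rbar_le_refl.
  - intros [A HA]. apply (esum_le a A Ha) in HA.
    pose proof (esum_pos a Ha) as Hp.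
    destruct (esum a); [reflexivity|destruct HA|destruct Hp].
Qed.

Lemma INR_S_ge1 i : 1 <= INR (S i).
Proof. rewrite S_INR. pose proof (pos_INR i). lra. Qed.

Lemma wt_ge1 n i : 1 <= wt n i.
Proof. apply pow_R1_Rle, INR_S_ge1. Qed.

Lemma wt_pos n i : 0 < wt n i.
Proof. pose proof (wt_ge1 n i). lra. Qed.

Lemma wt'_pos n i : 0 < wt' n i.
Proof. apply Rinv_0_lt_compat, wt_pos. Qed.

Lemma wt_mono n m i : (n <= m)%nat -> wt n i <= wt m i.
Proof. intros H. apply Rle_pow; [apply INR_S_ge1 | lia]. Qed.

Lemma wt'_mono n m i : (n <= m)%nat -> wt' m i <= wt' n i.
Proof. intros H. apply Rinv_le_contravar; [apply wt_pos | apply wt_mono; exact H]. Qed.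

(** With n and m unrelated, this makes the inclusion of s into s' contractive between any two
    indices; products in S are bounded through it. *)
Lemma wt'_le_wt n m i : wt' n i <= wt m i.
Proof.
  apply Rle_trans with 1; [|apply wt_ge1].
  unfold wt'. rewrite <- Rinv_1. apply Rinv_le_contravar; [lra|apply wt_ge1].
Qed.

Lemma term_pos (w : nat -> R) (xi : cseq) i : (forall i, 0 < w i) -> 0 <= Cmod (xi i) ^ 2 * w i.
Proof. intros Hw. apply Rmult_le_pos; [apply pow2_ge_0 | left; apply Hw]. Qed.

Lemma sqnorm_s_le n xi A : Rbar_le (sqnorm_s n xi) (Finite A) <-> bnd (wt n) xi A.
Proof.
  apply (esum_le (fun i => Cmod (xi i) ^ 2 * wt n i)). intros i. apply term_pos, wt_pos.
Qed.

Lemma ball_s'_bnd n xi : ball_s' n xi <-> bnd (wt' n) xi 1.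
Proof.
  apply (esum_le (fun i => Cmod (xi i) ^ 2 * wt' n i)). intros i. apply term_pos, wt'_pos.
Qed.

Lemma in_s_bnd xi : in_s xi <-> forall n, (1 <= n)%nat -> exists A, bnd (wt n) xi A.
Proof.
  split; intros H n Hn.
  - apply (esum_finite (fun i => Cmod (xi i) ^ 2 * wt n i)).
    + intros i. apply term_pos, wt_pos.
    + apply H, Hn.
  - apply (esum_finite (fun i => Cmod (xi i) ^ 2 * wt n i)).
    + intros i. apply term_pos, wt_pos.
    + apply H, Hn.
Qed.

Lemma in_s'_bnd xi : in_s' xi <-> exists n A, (1 <= n)%nat /\ bnd (wt' n) xi A.
Proof.
  split.
  - intros (n & Hn & H). exists n.
    apply (esum_finite (fun i => Cmod (xi i) ^ 2 * wt' n i)) in H;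
      [|intros i; apply term_pos, wt'_pos].
    destruct H as [A HA]. exists A. split; assumption.
  - intros (n & A & Hn & H). exists n. split; [exact Hn|].
    apply (esum_finite (fun i => Cmod (xi i) ^ 2 * wt' n i)).
    + intros i; apply term_pos, wt'_pos.
    + exists A. exact H.
Qed.

Lemma ball_in_s' n xi : (1 <= n)%nat -> bnd (wt' n) xi 1 -> in_s' xi.
Proof. intros Hn H. apply in_s'_bnd. exists n, 1. split; assumption. Qed.

Lemma bnd_w_mono (w v : nat -> R) xi A :
  (forall i, v i <= w i) -> bnd w xi A -> bnd v xi A.
Proof.
  intros Hwv H N. apply Rle_trans with (2 := H N). apply sum_n_R_le.
  intros i. apply Rmult_le_compat_l; [apply pow2_ge_0 | apply Hwv].
Qed.

Lemma bnd_le w xi A B : A <= B -> bnd w xi A -> bnd w xi B.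
Proof. intros HAB H N. specialize (H N). lra. Qed.

Lemma bnd_pos w xi A : (forall i, 0 < w i) -> bnd w xi A -> 0 <= A.
Proof.
  intros Hw H. apply Rle_trans with (2 := H O). apply sum_n_R_pos.
  intros i. apply term_pos, Hw.
Qed.

Lemma bnd_scal w xi A (c : C) : bnd w xi A -> bnd w (fun i => c * xi i)%C (Cmod c ^ 2 * A).
Proof.
  intros H N.
  rewrite (sum_n_R_ext _ (fun i => Cmod c ^ 2 * (Cmod (xi i) ^ 2 * w i) + 0 * 0)).
  - rewrite (sum_n_R_lin (Cmod c ^ 2) 0 _ (fun _ => 0)).
    specialize (H N). pose proof (pow2_ge_0 (Cmod c)). nra.
  - intros i. rewrite Cmod_mult. ring.
Qed.

Lemma Cmod_plus_sq (a b : C) : Cmod (a + b) ^ 2 <= 2 * Cmod a ^ 2 + 2 * Cmod b ^ 2.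
Proof.
  pose proof (Cmod_triangle a b). pose proof (Cmod_ge_0 (a + b)).
  pose proof (Cmod_ge_0 a). pose proof (Cmod_ge_0 b).
  apply Rle_trans with ((Cmod a + Cmod b) ^ 2).
  - apply pow_incr. lra.
  - pose proof (pow2_ge_0 (Cmod a - Cmod b)). nra.
Qed.

(** The crude factor 2 is harmless: sums only have to stay finite. *)
Lemma bnd_plus w xi eta A B :
  (forall i, 0 < w i) -> bnd w xi A -> bnd w eta B ->
  bnd w (fun i => xi i + eta i)%C (2 * A + 2 * B).
Proof.
  intros Hw H1 H2 N.
  apply Rle_trans with
    (sum_n (fun i => 2 * (Cmod (xi i) ^ 2 * w i) + 2 * (Cmod (eta i) ^ 2 * w i)) N).
  - apply sum_n_R_le. intros i. pose proof (Cmod_plus_sq (xi i) (eta i)).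
    specialize (Hw i). nra.
  - rewrite sum_n_R_lin. specialize (H1 N). specialize (H2 N). lra.
Qed.

Lemma bnd_zero w A : 0 <= A -> bnd w (fun _ => 0%C) A.
Proof.
  intros HA N. rewrite (sum_n_R_ext _ (fun i => 0 * 0 + 0 * 0)).
  - rewrite (sum_n_R_lin 0 0 (fun _ => 0) (fun _ => 0)). lra.
  - intros i. rewrite Cmod_0. ring.
Qed.

Lemma in_s_in_s' xi : in_s xi -> in_s' xi.
Proof.
  intros H. destruct (proj1 (in_s_bnd xi) H 1%nat (le_n _)) as [A HA].
  apply in_s'_bnd. exists 1%nat, A. split; [lia|].
  apply bnd_w_mono with (2 := HA). intros i. apply wt'_le_wt.
Qed.

Lemma in_s'_lin (a : C) xi eta :
  in_s' xi -> in_s' eta -> in_s' (fun j => a * xi j + eta j)%C.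
Proof.
  rewrite !in_s'_bnd. intros (n & A & Hn & HA) (m & B & Hm & HB).
  exists (max n m), (2 * (Cmod a ^ 2 * A) + 2 * B). split; [lia|].
  apply (bnd_plus _ (fun i => a * xi i)%C).
  - intros i; apply wt'_pos.
  - apply bnd_scal. apply bnd_w_mono with (2 := HA). intros i. apply wt'_mono. lia.
  - apply bnd_w_mono with (2 := HB). intros i. apply wt'_mono. lia.
Qed.

(** * Complex series and the pairing *)

Definition csum (a : nat -> C) (N : nat) : C := (sum_n (fun i => Re (a i)) N, sum_n (fun i => Im (a i)) N).

Lemma csum_S a N : csum a (S N) = (csum a N + a (S N))%C.
Proof. unfold csum. rewrite !sum_n_R_S. reflexivity. Qed.

Lemma csum_O a : csum a 0 = a O.
Proof. unfold csum. rewrite !sum_n_R_O. destruct (a O). reflexivity. Qed.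

Lemma CSeries_limit (a : nat -> C) (l : C) :
  (forall eps, 0 < eps -> exists N, forall M, (N <= M)%nat -> Cmod (csum a M - l) <= eps) ->
  CSeries a = l.
Proof.
  intros H. unfold CSeries.
  assert (HR : Series (fun i => Re (a i)) = Re l).
  { apply is_series_unique. apply is_lim_seq_Reals. intros eps Heps.
    destruct (H (eps / 2)) as [N HN]; [lra|]. exists N. intros M HM.
    specialize (HN M HM). unfold R_dist.
    pose proof (re_le_Cmod (csum a M - l)%C) as Hr.
    apply Rle_lt_trans with (eps / 2); [|lra].
    apply Rle_trans with (2 := HN). exact Hr. }
  assert (HI : Series (fun i => Im (a i)) = Im l).
  { apply is_series_unique. apply is_lim_seq_Reals. intros eps Heps.
    destruct (H (eps / 2)) as [N HN]; [lra|]. exists N. intros M HM.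
    specialize (HN M HM). unfold R_dist.
    pose proof (Rmax_Cmod (csum a M - l)%C) as Hr.
    apply Rle_lt_trans with (eps / 2); [|lra].
    apply Rle_trans with (2 := HN). apply Rle_trans with (2 := Hr). apply Rmax_r. }
  rewrite HR, HI. destruct l; reflexivity.
Qed.

Lemma ex_series_bounded (a : nat -> R) (A : R) :
  (forall i, 0 <= a i) -> (forall N, sum_n a N <= A) -> ex_series a.
Proof.
  intros Ha H. destruct (ex_finite_lim_seq_incr (sum_n a) A) as [l Hl].
  - intros N. rewrite sum_n_R_S. specialize (Ha (S N)). lra.
  - exact H.
  - exists l. exact Hl.
Qed.

Lemma Series_le_bound (a : nat -> R) (A : R) :
  (forall i, 0 <= a i) -> (forall N, sum_n a N <= A) -> Series a <= A.
Proof.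
  intros Ha H. pose proof (ex_series_bounded a A Ha H) as He.
  apply Series_correct in He.
  assert (Hl : is_lim_seq (sum_n a) (Series a)) by exact He.
  change (Rbar_le (Finite (Series a)) (Finite A)).
  apply is_lim_seq_le with (1 := H) (2 := Hl). apply is_lim_seq_const.
Qed.

Lemma sum_n_le_Series (a : nat -> R) N :
  (forall i, 0 <= a i) -> ex_series a -> sum_n a N <= Series a.
Proof.
  intros Ha He. apply (is_lim_seq_incr_compare (sum_n a)).
  - apply Series_correct in He. exact He.
  - intros m. rewrite sum_n_R_S. specialize (Ha (S m)). lra.
Qed.

Lemma ex_series_comp (a : nat -> C) (f : C -> R) :
  (forall z, Rabs (f z) <= Cmod z) ->
  ex_series (fun i => Cmod (a i)) -> ex_series (fun i => f (a i)).
Proof.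
  intros Hf He. apply ex_series_Rabs.
  apply (ex_series_le (K := R_AbsRing) (V := R_CompleteNormedModule)
           (fun i => Rabs (f (a i))) (fun i => Cmod (a i))); [|exact He].
  intros i. unfold norm; simpl. unfold abs; simpl. rewrite Rabs_Rabsolu. apply Hf.
Qed.

Lemma Rabs_Im_le (z : C) : Rabs (Im z) <= Cmod z.
Proof. apply Rle_trans with (2 := Rmax_Cmod z). apply Rmax_r. Qed.

Lemma ex_series_Rscal (c : R) (a : nat -> R) : ex_series a -> ex_series (fun i => c * a i).
Proof. exact (ex_series_scal (K := R_AbsRing) (V := R_NormedModule) c a). Qed.

Lemma CSeries_lin (c : C) (a b : nat -> C) :
  ex_series (fun i => Cmod (a i)) -> ex_series (fun i => Cmod (b i)) ->
  CSeries (fun i => c * a i + b i)%C = (c * CSeries a + CSeries b)%C.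
Proof.
  intros Ha Hb. unfold CSeries.
  pose proof (ex_series_comp a Re re_le_Cmod Ha) as HaR.
  pose proof (ex_series_comp a Im Rabs_Im_le Ha) as HaI.
  pose proof (ex_series_comp b Re re_le_Cmod Hb) as HbR.
  pose proof (ex_series_comp b Im Rabs_Im_le Hb) as HbI.
  apply injective_projections; simpl.
  - rewrite (Series_ext _ (fun i => (Re c * Re (a i) + (- Im c) * Im (a i)) + Re (b i)))
      by (intros i; unfold Re, Im; simpl; ring).
    rewrite Series_plus, Series_plus, !Series_scal_l.
    + unfold Re, Im. ring.
    + apply (ex_series_Rscal (Re c)). exact HaR.
    + apply (ex_series_Rscal (- Im c)). exact HaI.
    + apply (ex_series_plus (V := R_NormedModule)).
      * apply (ex_series_Rscal (Re c)). exact HaR.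
      * apply (ex_series_Rscal (- Im c)). exact HaI.
    + exact HbR.
  - rewrite (Series_ext _ (fun i => (Re c * Im (a i) + Im c * Re (a i)) + Im (b i)))
      by (intros i; unfold Re, Im; simpl; ring).
    rewrite Series_plus, Series_plus, !Series_scal_l.
    + unfold Re, Im. ring.
    + apply (ex_series_Rscal (Re c)). exact HaI.
    + apply (ex_series_Rscal (Im c)). exact HaR.
    + apply (ex_series_plus (V := R_NormedModule)).
      * apply (ex_series_Rscal (Re c)). exact HaI.
      * apply (ex_series_Rscal (Im c)). exact HaR.
    + exact HbI.
Qed.

Lemma CSeries_ext (a b : nat -> C) : (forall i, a i = b i) -> CSeries a = CSeries b.
Proof. intros H. f_equal. apply functional_extensionality. exact H. Qed.

Lemma CSeries_zero : CSeries (fun _ => 0%C) = 0%C.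
Proof.
  apply CSeries_limit. intros eps Heps. exists O. intros M _.
  assert (E : csum (fun _ => RtoC 0) M = RtoC 0).
  - induction M as [|M IH]; [rewrite csum_O; reflexivity|]. rewrite csum_S, IH. ring.
  - rewrite E. replace (0 - 0)%C with (RtoC 0) by ring. rewrite Cmod_0. lra.
Qed.

(* The unimodular factor that makes z nonnegative. *)
Definition phase (z : C) : C := if Ceq_dec z 0 then 1%C else (Cconj z / Cmod z)%C.

Lemma phase_spec (z : C) : Cmod (phase z) = 1 /\ (phase z * z)%C = RtoC (Cmod z).
Proof.
  unfold phase. destruct (Ceq_dec z 0) as [->|Hz].
  - rewrite Cmod_1, Cmod_0. split; [reflexivity|ring].
  - assert (Hm : Cmod z <> 0) by (intros E; apply Hz, Cmod_eq_0, E).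
    assert (HmC : RtoC (Cmod z) <> 0%C) by (intros E; apply Hm; injection E; auto).
    pose proof (Cmod_ge_0 z).
    split.
    + rewrite Cmod_div, Cmod_conj, Cmod_R, Rabs_pos_eq by assumption. field. exact Hm.
    + replace (Cconj z / Cmod z * z)%C with ((z * Cconj z) / Cmod z)%C by (field; exact HmC).
      rewrite <- Cmod2_conj, <- RtoC_div by exact Hm. f_equal. field. exact Hm.
Qed.

Lemma Cmod_CSeries_le (a : nat -> C) (A : R) :
  (forall N, sum_n (fun i => Cmod (a i)) N <= A) -> Cmod (CSeries a) <= A.
Proof.
  intros H.
  assert (He : ex_series (fun i => Cmod (a i)))
    by (apply ex_series_bounded with A; [intros i; apply Cmod_ge_0|exact H]).
  destruct (phase_spec (CSeries a)) as [Hp1 Hp2].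
  set (c := phase (CSeries a)) in *.
  (* Rotating by the phase makes the sum equal to its modulus, so a bound on the series of real
     parts suffices; the [+ 0] fits the shape of [CSeries_lin]. *)
  assert (E : CSeries (fun i => c * a i + 0)%C = RtoC (Cmod (CSeries a))).
  { rewrite <- Hp2, CSeries_lin, CSeries_zero; [ring|exact He|].
    apply ex_series_bounded with 0; [intros _; apply Cmod_ge_0|].
    intros N. rewrite (sum_n_R_ext _ (fun i => 0 * 0 + 0 * 0)).
    - rewrite (sum_n_R_lin 0 0 (fun _ => 0) (fun _ => 0)). lra.
    - intros _. rewrite Cmod_0. ring. }
  assert (E2 : Series (fun i => Re (c * a i + 0)%C) = Cmod (CSeries a))
    by (change (fst (CSeries (fun i => c * a i + 0)%C) = Cmod (CSeries a)); rewrite E; reflexivity).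
  rewrite <- E2.
  apply Rle_trans with (Series (fun i => Cmod (a i))).
  - apply Rle_trans with (1 := Rle_abs _).
    assert (Hle : forall i, 0 <= Rabs (Re (c * a i + 0)%C) <= Cmod (a i)).
    { intros i. split; [apply Rabs_pos|]. apply Rle_trans with (1 := re_le_Cmod _).
      rewrite Cplus_0_r, Cmod_mult, Hp1. lra. }
    assert (Hs : ex_series (fun i => Rabs (Re (c * a i + 0)%C))).
    { apply ex_series_bounded with A; [intros i; apply Rabs_pos|].
      intros N. apply Rle_trans with (2 := H N). apply sum_n_R_le. intros i. apply Hle. }
    apply Rle_trans with (1 := Series_Rabs _ Hs).
    apply Series_le; [exact Hle|exact He].
  - apply Series_le_bound; [intros i; apply Cmod_ge_0|exact H].
Qed.

Lemma CSeries_conj (a : nat -> C) : CSeries (fun i => Cconj (a i)) = Cconj (CSeries a).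
Proof.
  unfold CSeries, Cconj. simpl. f_equal. rewrite <- Series_opp. reflexivity.
Qed.

Lemma sum_CS (a b : nat -> R) N :
  (forall i, 0 <= a i) -> (forall i, 0 <= b i) ->
  sum_n (fun i => a i * b i) N <= sqrt (sum_n (fun i => a i ^ 2) N) * sqrt (sum_n (fun i => b i ^ 2) N).
Proof.
  intros Ha Hb. induction N as [|N IH].
  - rewrite !sum_n_R_O. rewrite !sqrt_pow2 by auto. lra.
  - rewrite !sum_n_R_S.
    pose proof (sum_n_R_pos (fun i => a i ^ 2) N (fun i => pow2_ge_0 _)) as HA.
    pose proof (sum_n_R_pos (fun i => b i ^ 2) N (fun i => pow2_ge_0 _)) as HB.
    set (A := sum_n (fun i => a i ^ 2) N) in *. set (B := sum_n (fun i => b i ^ 2) N) in *.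
    apply Rle_trans with (1 := Rplus_le_compat_r _ _ _ IH).
    rewrite <- (sqrt_mult (A + a (S N) ^ 2) (B + b (S N) ^ 2)) by ( pose proof (pow2_ge_0 (a (S N))); pose proof (pow2_ge_0 (b (S N))); lra).
    pose proof (sqrt_sqrt A HA) as EA. pose proof (sqrt_sqrt B HB) as EB.
    pose proof (sqrt_pos A). pose proof (sqrt_pos B).
    set (s := sqrt A) in *. set (t := sqrt B) in *.
    pose proof (Ha (S N)). pose proof (Hb (S N)).
    set (x := a (S N)) in *. set (y := b (S N)) in *.
    assert (0 <= s * t) by (apply Rmult_le_pos; assumption).
    assert (0 <= x * y) by (apply Rmult_le_pos; assumption).
    rewrite <- (sqrt_pow2 (s * t + x * y)) by lra.
    apply sqrt_le_1_alt. rewrite <- EA, <- EB.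
    (* (s^2 + x^2)(t^2 + y^2) - (s t + x y)^2 is exactly this square. *)
    pose proof (pow2_ge_0 (s * y - t * x)). nra.
Qed.

(** [CSeries] has a value even for divergent series; absolute convergence is what makes [pairing]
    linear. *)
Definition pairable (xi eta : cseq) : Prop :=
  ex_series (fun i => Cmod (xi i * Cconj (eta i))%C).

(** The dual weight is a parameter so that one estimate serves both orders, s against s' and s'
    against s. *)
Lemma weighted_CS (w v : nat -> R) xi eta A B :
  (forall i, 0 < w i) -> (forall i, v i = / w i) ->
  bnd w xi A -> bnd v eta B ->
  forall N, sum_n (fun i => Cmod (xi i * Cconj (eta i))%C) N <= sqrt A * sqrt B.
Proof.
  intros Hw Hv H1 H2 N.
  rewrite (sum_n_R_ext _ (fun i => (Cmod (xi i) * sqrt (w i)) * (Cmod (eta i) * sqrt (v i)))).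
  - apply Rle_trans with (1 := sum_CS _ _ N
      (fun i => Rmult_le_pos _ _ (Cmod_ge_0 _) (sqrt_pos _))
      (fun i => Rmult_le_pos _ _ (Cmod_ge_0 _) (sqrt_pos _))).
    apply Rmult_le_compat; try apply sqrt_pos; apply sqrt_le_1_alt.
    + apply Rle_trans with (2 := H1 N). right. apply sum_n_R_ext. intros i.
      rewrite Rpow_mult_distr, pow2_sqrt by (left; apply Hw). reflexivity.
    + apply Rle_trans with (2 := H2 N). right. apply sum_n_R_ext. intros i.
      rewrite Rpow_mult_distr, pow2_sqrt by (rewrite Hv; left; apply Rinv_0_lt_compat, Hw).
      reflexivity.
  - intros i. rewrite Cmod_mult, Cmod_conj, Hv, sqrt_inv.
    assert (sqrt (w i) <> 0) by (apply Rgt_not_eq, sqrt_lt_R0, Hw).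
    field. assumption.
Qed.

Lemma pairable_CS (w v : nat -> R) xi eta A B :
  (forall i, 0 < w i) -> (forall i, v i = / w i) ->
  bnd w xi A -> bnd v eta B -> pairable xi eta.
Proof.
  intros Hw Hv H1 H2. apply ex_series_bounded with (sqrt A * sqrt B).
  - intros i. apply Cmod_ge_0.
  - apply (weighted_CS w v); assumption.
Qed.

Lemma pairing_CS (w v : nat -> R) xi eta A B :
  (forall i, 0 < w i) -> (forall i, v i = / w i) ->
  bnd w xi A -> bnd v eta B -> Cmod (pairing xi eta) <= sqrt A * sqrt B.
Proof.
  intros Hw Hv H1 H2. apply Cmod_CSeries_le. apply (weighted_CS w v); assumption.
Qed.

Lemma wt_inv n i : wt' n i = / wt n i.
Proof. reflexivity. Qed.

Lemma wt'_inv n i : wt n i = / wt' n i.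
Proof. unfold wt'. rewrite Rinv_inv. reflexivity. Qed.

Lemma pairing_conj xi eta : pairing eta xi = Cconj (pairing xi eta).
Proof.
  unfold pairing. rewrite <- CSeries_conj. apply CSeries_ext. intros i.
  rewrite Cmult_conj, Cconj_conj. ring.
Qed.

Lemma pairable_sym xi eta : pairable xi eta -> pairable eta xi.
Proof.
  intros H. apply ex_series_ext with (2 := H). intros i.
  rewrite !Cmod_mult, !Cmod_conj. rring.
Qed.

Lemma pairing_lin_l (a : C) xi1 xi2 eta :
  pairable xi1 eta -> pairable xi2 eta ->
  pairing (fun j => a * xi1 j + xi2 j)%C eta = (a * pairing xi1 eta + pairing xi2 eta)%C.
Proof.
  intros H1 H2. unfold pairing. rewrite <- CSeries_lin by assumption.
  apply CSeries_ext. intros i. ring.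
Qed.

Lemma pairing_lin_r (a : C) xi eta1 eta2 :
  pairable xi eta1 -> pairable xi eta2 ->
  pairing xi (fun j => a * eta1 j + eta2 j)%C
  = (Cconj a * pairing xi eta1 + pairing xi eta2)%C.
Proof.
  intros H1 H2. rewrite pairing_conj, pairing_lin_l by (apply pairable_sym; assumption).
  rewrite Cplus_conj, Cmult_conj, <- !pairing_conj. reflexivity.
Qed.

Lemma pairable_s_s' xi eta : in_s xi -> in_s' eta -> pairable xi eta.
Proof.
  intros H1 H2. apply in_s'_bnd in H2. destruct H2 as (n & B & Hn & HB).
  destruct (proj1 (in_s_bnd xi) H1 n Hn) as [A HA].
  apply (pairable_CS (wt n) (wt' n) xi eta A B); auto using wt_pos, wt_inv.
Qed.

(** * Coordinate vectors and truncations *)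

Definition basis (i : nat) : cseq := fun j => if Nat.eq_dec i j then 1%C else 0%C.

Lemma csum_single (a : nat -> C) i N :
  (forall j, j <> i -> a j = 0%C) -> csum a N = if le_dec i N then a i else 0%C.
Proof.
  intros H. induction N as [|N IH].
  - rewrite csum_O. destruct (le_dec i 0) as [Hi|Hi].
    + replace i with O by lia. reflexivity.
    + apply H. lia.
  - rewrite csum_S, IH. destruct (le_dec i N), (le_dec i (S N)); try lia.
    + rewrite (H (S N)) by lia. ring.
    + replace i with (S N) by lia. ring.
    + rewrite (H (S N)) by lia. ring.
Qed.

Lemma pairing_basis_r xi i : pairing xi (basis i) = xi i.
Proof.
  apply CSeries_limit. intros eps Heps. exists i. intros M HM.
  rewrite (csum_single _ i).
  - destruct (le_dec i M); [|lia]. unfold basis. destruct (Nat.eq_dec i i); [|lia].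
    replace (xi i * Cconj 1 - xi i)%C with (RtoC 0); [rewrite Cmod_0; lra|].
    apply injective_projections; simpl; ring.
  - intros j Hj. unfold basis. destruct (Nat.eq_dec i j); [lia|].
    apply injective_projections; simpl; ring.
Qed.

Lemma sum_n_single (a : nat -> R) i N :
  (forall j, j <> i -> a j = 0) -> sum_n a N = if le_dec i N then a i else 0.
Proof.
  intros H. induction N as [|N IH].
  - rewrite sum_n_R_O. destruct (le_dec i 0) as [Hi|Hi].
    + replace i with O by lia. reflexivity.
    + apply H. lia.
  - rewrite sum_n_R_S, IH. destruct (le_dec i N), (le_dec i (S N)); try lia.
    + rewrite (H (S N)) by lia. rring.
    + replace i with (S N) by lia. rring.
    + rewrite (H (S N)) by lia. rring.
Qed.

Lemma bnd_basis w i : (forall j, 0 < w j) -> bnd w (basis i) (w i).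
Proof.
  intros Hw N. rewrite (sum_n_single _ i).
  - specialize (Hw i). destruct (le_dec i N); [|lra].
    unfold basis. destruct (Nat.eq_dec i i); [|lia]. rewrite Cmod_1. lra.
  - intros j Hj. unfold basis. destruct (Nat.eq_dec i j); [lia|]. rewrite Cmod_0. ring.
Qed.

Lemma basis_in_s' i : in_s' (basis i).
Proof.
  apply in_s'_bnd. exists 1%nat, (wt' 1 i). split; [lia|]. apply bnd_basis, wt'_pos.
Qed.

Lemma in_s'_zero : in_s' (fun _ => 0%C).
Proof. apply in_s'_bnd. exists 1%nat, 0. split; [lia|]. apply bnd_zero. lra. Qed.

Definition trunc (N : nat) (xi : cseq) : cseq := fun i => if le_dec i N then xi i else 0%C.

Lemma trunc_S N xi :
  trunc (S N) xi = (fun j => xi (S N) * basis (S N) j + trunc N xi j)%C.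
Proof.
  apply functional_extensionality. intros j. unfold trunc, basis.
  destruct (le_dec j (S N)), (le_dec j N), (Nat.eq_dec (S N) j); try lia; subst; ring.
Qed.

Lemma trunc_O xi : trunc 0 xi = (fun j => xi O * basis O j + 0)%C.
Proof.
  apply functional_extensionality. intros j. unfold trunc, basis.
  destruct (le_dec j 0), (Nat.eq_dec 0 j); try lia; subst; ring.
Qed.

Lemma bnd_trunc w N xi : (forall i, 0 < w i) ->
  bnd w (trunc N xi) (sum_n (fun i => Cmod (xi i) ^ 2 * w i) N).
Proof.
  intros Hw M. destruct (le_dec M N) as [H|H].
  - apply Rle_trans with (sum_n (fun i => Cmod (xi i) ^ 2 * w i) M).
    + right. apply sum_n_R_ext_loc. intros i Hi. unfold trunc.
      destruct (le_dec i N); [reflexivity|lia].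
    + apply sum_n_R_mono; [|exact H]. intros i. apply term_pos, Hw.
  - assert (HM : (N <= M)%nat) by lia. clear H. induction HM as [|M HM IH].
    + right. apply sum_n_R_ext_loc. intros i Hi. unfold trunc.
      destruct (le_dec i N); [reflexivity|lia].
    + rewrite sum_n_R_S. unfold trunc at 2. destruct (le_dec (S M) N); [lia|].
      rewrite Cmod_0. lra.
Qed.

Lemma trunc_in_s' N xi : in_s' (trunc N xi).
Proof.
  apply in_s'_bnd. exists 1%nat. eexists. split; [lia|]. apply bnd_trunc, wt'_pos.
Qed.

(** Truncation and tail have disjoint supports, so the squared lengths subtract exactly. *)
Lemma bnd_tail w N xi A : (forall i, 0 < w i) -> bnd w xi A ->
  bnd w (fun i => xi i - trunc N xi i)%C (A - sum_n (fun i => Cmod (xi i) ^ 2 * w i) N).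
Proof.
  intros Hw HA M.
  assert (E : forall i, Cmod (xi i - trunc N xi i) ^ 2 * w i
     = 1 * (Cmod (xi i) ^ 2 * w i) + (-1) * (Cmod (trunc N xi i) ^ 2 * w i)).
  { intros i. unfold trunc. destruct (le_dec i N).
    - replace (xi i - xi i)%C with (RtoC 0) by ring. rewrite Cmod_0. ring.
    - replace (xi i - 0)%C with (xi i) by ring. rewrite Cmod_0. ring. }
  destruct (le_dec M N) as [HM|HM].
  - apply Rle_trans with 0; [|specialize (HA N); lra].
    rewrite (sum_n_R_ext_loc _ (fun i => 0 * 0 + 0 * 0)).
    + rewrite (sum_n_R_lin 0 0 (fun _ => 0) (fun _ => 0)). lra.
    + intros i Hi. unfold trunc. destruct (le_dec i N); [|lia].
      replace (xi i - xi i)%C with (RtoC 0) by ring. rewrite Cmod_0. ring.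
  - rewrite (sum_n_R_ext _ _ M E), sum_n_R_lin.
    assert (sum_n (fun i => Cmod (xi i) ^ 2 * w i) N
            <= sum_n (fun i => Cmod (trunc N xi i) ^ 2 * w i) M).
    { apply Rle_trans with (sum_n (fun i => Cmod (trunc N xi i) ^ 2 * w i) N).
      - right. apply sum_n_R_ext_loc. intros i Hi. unfold trunc.
        destruct (le_dec i N); [reflexivity|lia].
      - apply sum_n_R_mono; [|lia]. intros i. apply term_pos, Hw. }
    specialize (HA M). lra.
Qed.

(** * Operators *)

Definition nrm (n : nat) (x : op) : R := real (opnorm n x).

Lemma opnorm_le n x (c : R) : 0 <= c ->
  (forall xi, bnd (wt' n) xi 1 -> bnd (wt n) (x xi) (c ^ 2)) ->
  Rbar_le (opnorm n x) (Finite c).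
Proof.
  intros Hc H. apply (proj2 (Lub_Rbar_correct _)).
  intros r (xi & Hb & Hr). apply Rbar_le_trans with (1 := Hr).
  apply ball_s'_bnd in Hb. apply H in Hb. apply sqnorm_s_le in Hb.
  destruct (sqnorm_s n (x xi)) as [v| |]; simpl in *.
  - rewrite <- (sqrt_pow2 c Hc). apply sqrt_le_1_alt. exact Hb.
  - destruct Hb.
  - exact Hc.
Qed.

Lemma opnorm_pos n x : Rbar_le (Finite 0) (opnorm n x).
Proof.
  apply (proj1 (Lub_Rbar_correct _)). exists (fun _ => RtoC 0). split.
  - apply ball_s'_bnd. apply bnd_zero. lra.
  - destruct (sqnorm_s n (x (fun _ => RtoC 0))) as [v| |]; simpl; try exact I; try lra.
    apply sqrt_pos.
Qed.

Lemma opnorm_nrm n x : in_S x -> (1 <= n)%nat -> opnorm n x = Finite (nrm n x).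
Proof. intros (_ & _ & H) Hn. symmetry. apply H, Hn. Qed.

Lemma nrm_pos n x : 0 <= nrm n x.
Proof.
  unfold nrm. pose proof (opnorm_pos n x). destruct (opnorm n x); simpl in *; lra.
Qed.

Lemma nrm_le n x c : in_S x -> (1 <= n)%nat -> 0 <= c ->
  (forall xi, bnd (wt' n) xi 1 -> bnd (wt n) (x xi) (c ^ 2)) -> nrm n x <= c.
Proof.
  intros Hx Hn Hc H. apply opnorm_le in H; [|exact Hc].
  rewrite (opnorm_nrm n x Hx Hn) in H. exact H.
Qed.

Lemma in_S_apply x xi : in_S x -> in_s' xi -> in_s (x xi).
Proof. intros (H & _) Hxi. apply H, Hxi. Qed.

Lemma in_S_apply' x xi : in_S x -> in_s' xi -> in_s' (x xi).
Proof. intros H Hxi. apply in_s_in_s', in_S_apply; assumption. Qed.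

Lemma in_S_lin x (a : C) xi eta : in_S x -> in_s' xi -> in_s' eta ->
  x (fun j => a * xi j + eta j)%C = (fun i => a * x xi i + x eta i)%C.
Proof.
  intros (_ & H & _) H1 H2. apply functional_extensionality. intros i. apply H; assumption.
Qed.

Lemma in_S_zero_vec x : in_S x -> x (fun _ => RtoC 0) = (fun _ => RtoC 0).
Proof.
  intros Hx. pose proof (in_S_lin x 1%C _ _ Hx in_s'_zero in_s'_zero) as H.
  cbv beta in H.
  replace (fun _ : nat => (1 * 0 + 0)%C) with (fun _ : nat => RtoC 0) in H
    by (apply functional_extensionality; intros; ring).
  apply functional_extensionality. intros i.
  pose proof (equal_f H i) as Hi. cbv beta in Hi.
  set (z := x (fun _ => RtoC 0) i) in *.
  transitivity (1 * z + z - z)%C; [ring|]. rewrite <- Hi. ring.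
Qed.

Lemma in_S_scal_vec x (a : C) xi : in_S x -> in_s' xi ->
  x (fun j => a * xi j)%C = (fun i => a * x xi i)%C.
Proof.
  intros Hx Hxi. pose proof (in_S_lin x a xi _ Hx Hxi in_s'_zero) as H.
  cbv beta in H.
  rewrite (in_S_zero_vec x Hx) in H.
  replace (fun j => (a * xi j)%C) with (fun j => (a * xi j + 0)%C)
    by (apply functional_extensionality; intros; ring).
  rewrite H. apply functional_extensionality; intros; ring.
Qed.

Lemma op_bound_ball x n xi : in_S x -> (1 <= n)%nat ->
  bnd (wt' n) xi 1 -> bnd (wt n) (x xi) (nrm n x ^ 2).
Proof.
  intros Hx Hn Hb. apply sqnorm_s_le.
  pose proof (in_S_apply x xi Hx (ball_in_s' n xi Hn Hb) n Hn) as Hf.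
  assert (Hle : Rbar_le (Rbar_sqrt (sqnorm_s n (x xi))) (Finite (nrm n x))).
  { rewrite <- (opnorm_nrm n x Hx Hn). rewrite <- Hf. simpl.
    apply (proj1 (Lub_Rbar_correct _)). exists xi. split.
    - apply ball_s'_bnd, Hb.
    - rewrite <- Hf. apply Rbar_le_refl. }
  rewrite <- Hf in *. simpl Rbar_sqrt in Hle. simpl Rbar_le in Hle |- *. change (real (sqnorm_s n (x xi)) <= nrm n x ^ 2).
  destruct (Rle_dec 0 (sqnorm_s n (x xi))) as [Hp|Hp].
  - rewrite <- (pow2_sqrt _ Hp). apply pow_incr. split; [apply sqrt_pos|exact Hle].
  - pose proof (pow2_ge_0 (nrm n x)). lra.
Qed.

Lemma op_bound x n xi A : in_S x -> (1 <= n)%nat ->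
  bnd (wt' n) xi A -> bnd (wt n) (x xi) (nrm n x ^ 2 * A).
Proof.
  intros Hx Hn HA N.
  pose proof (bnd_pos _ _ _ (wt'_pos n) HA) as HA0.
  set (c := nrm n x ^ 2). assert (Hc : 0 <= c) by apply pow2_ge_0.
  (* Normalising by some B > A rather than by A covers A = 0; afterwards B tends to A. *)
  assert (HB : forall B, A < B -> sum_n (fun i => Cmod (x xi i) ^ 2 * wt n i) N <= c * B).
  { intros B HB. assert (HsB : 0 < sqrt B) by (apply sqrt_lt_R0; lra).
    assert (HsBC : RtoC (sqrt B) <> 0%C) by (intros E; injection E; lra).
    set (eta := fun i => (/ sqrt B * xi i)%C).
    assert (Hs : sqrt B * sqrt B = B) by (apply sqrt_sqrt; lra).
    assert (HCi : Cmod (/ sqrt B)%C ^ 2 = / B).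
    { rewrite Cmod_inv, Cmod_R, Rabs_pos_eq by (try assumption; lra).
      rewrite <- Hs at 2. field. lra. }
    assert (Heta : bnd (wt' n) eta 1).
    { apply bnd_le with (Cmod (/ sqrt B)%C ^ 2 * A).
      - rewrite HCi. apply Rmult_le_reg_l with B; [lra|]. field_simplify; lra.
      - apply bnd_scal, HA. }
    assert (Exi : xi = (fun j => sqrt B * eta j)%C).
    { apply functional_extensionality. intros j. unfold eta. field. exact HsBC. }
    pose proof (op_bound_ball x n eta Hx Hn Heta) as H1.
    apply (bnd_scal _ _ _ (RtoC (sqrt B))) in H1.
    rewrite Exi, (in_S_scal_vec x _ eta Hx (ball_in_s' n eta Hn Heta)).
    apply Rle_trans with (1 := H1 N). fold c.
    rewrite Cmod_R, Rabs_pos_eq by lra. replace (sqrt B ^ 2) with B by (rewrite <- Hs at 1; ring).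
    lra. }
  apply le_epsilon. intros eps Heps.
  assert (Hd : 0 < eps / (c + 1)) by (apply Rdiv_lt_0_compat; lra).
  specialize (HB (A + eps / (c + 1))). apply Rle_trans with (1 := HB ltac:(lra)).
  assert (eps / (c + 1) * (c + 1) = eps) by (field; lra). nra.
Qed.

(** One bound per index n, from |.|_n' to |.|_n, is enough: a vector with finite |.|_m' has its
    image estimated in |.|_n through the index max n m. *)
Lemma in_S_intro (x : op) :
  (forall (a : C) xi eta, in_s' xi -> in_s' eta ->
      forall i, x (fun j => a * xi j + eta j)%C i = (a * x xi i + x eta i)%C) ->
  (forall n, (1 <= n)%nat -> exists c, 0 <= c /\
     forall xi A, bnd (wt' n) xi A -> bnd (wt n) (x xi) (c ^ 2 * A)) ->
  in_S x.
Proof.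
  intros Hl Hb. split; [|split].
  - intros xi Hxi. apply in_s'_bnd in Hxi. destruct Hxi as (m & A & Hm & HA).
    apply in_s_bnd. intros n Hn.
    destruct (Hb (max n m)) as (c & Hc & H); [lia|].
    exists (c ^ 2 * A). apply bnd_w_mono with (wt (max n m)).
    + intros i. apply wt_mono. lia.
    + apply H. apply bnd_w_mono with (2 := HA). intros i. apply wt'_mono. lia.
  - exact Hl.
  - intros n Hn. destruct (Hb n Hn) as (c & Hc & H).
    assert (Hle : Rbar_le (opnorm n x) (Finite c)).
    { apply opnorm_le; [exact Hc|]. intros xi Hxi. apply bnd_le with (c ^ 2 * 1); [lra|].
      apply H, Hxi. }
    pose proof (opnorm_pos n x) as Hp.
    destruct (opnorm n x); [reflexivity|destruct Hle|destruct Hp].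
Qed.

Lemma in_S_opzero : in_S opzero.
Proof.
  apply in_S_intro.
  - intros. unfold opzero. ring.
  - intros n Hn. exists 0. split; [lra|]. intros xi A HA. apply bnd_zero. lra.
Qed.

Lemma nrm_opzero n : (1 <= n)%nat -> nrm n opzero = 0.
Proof.
  intros Hn. apply Rle_antisym; [|apply nrm_pos].
  apply nrm_le; auto using in_S_opzero; [lra|].
  intros xi _. apply bnd_zero. lra.
Qed.

Lemma in_S_lincomb (a : C) x y : in_S x -> in_S y -> in_S (opadd (opscal a x) y).
Proof.
  intros Hx Hy. apply in_S_intro.
  - intros b xi eta H1 H2 i. unfold opadd, opscal.
    rewrite (in_S_lin x), (in_S_lin y) by assumption. ring.
  - intros n Hn. exists (sqrt (2 * (Cmod a ^ 2 * nrm n x ^ 2) + 2 * nrm n y ^ 2)).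
    split; [apply sqrt_pos|]. intros xi A HA.
    rewrite pow2_sqrt.
    + apply bnd_le with (2 * (Cmod a ^ 2 * (nrm n x ^ 2 * A)) + 2 * (nrm n y ^ 2 * A)); [lra|].
      apply (bnd_plus _ (fun i => a * x xi i)%C).
      * apply wt_pos.
      * apply bnd_scal, op_bound; assumption.
      * apply op_bound; assumption.
    + pose proof (pow2_ge_0 (Cmod a)). pose proof (pow2_ge_0 (nrm n x)).
      pose proof (pow2_ge_0 (nrm n y)). nra.
Qed.

Lemma opadd_scal1 x y : opadd x y = opadd (opscal 1 x) y.
Proof.
  do 2 (apply functional_extensionality; intros ?). unfold opadd, opscal. ring.
Qed.

Lemma opscal_zero a x : opscal a x = opadd (opscal a x) opzero.
Proof.
  do 2 (apply functional_extensionality; intros ?). unfold opadd, opscal, opzero. ring.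
Qed.

Lemma in_S_opadd x y : in_S x -> in_S y -> in_S (opadd x y).
Proof. intros. rewrite opadd_scal1. apply in_S_lincomb; assumption. Qed.

Lemma in_S_opscal a x : in_S x -> in_S (opscal a x).
Proof. intros. rewrite opscal_zero. apply in_S_lincomb; [assumption|apply in_S_opzero]. Qed.

Lemma nrm_opscal n a x : in_S x -> (1 <= n)%nat -> nrm n (opscal a x) <= Cmod a * nrm n x.
Proof.
  intros Hx Hn. apply nrm_le; auto using in_S_opscal.
  - apply Rmult_le_pos; [apply Cmod_ge_0|apply nrm_pos].
  - intros xi Hxi. rewrite Rpow_mult_distr. apply (bnd_scal _ (x xi)). apply op_bound_ball; assumption.
Qed.

Lemma in_S_opmul x y : in_S x -> in_S y -> in_S (opmul x y).
Proof.
  intros Hx Hy. apply in_S_intro.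
  - intros b xi eta H1 H2 i. unfold opmul.
    rewrite (in_S_lin y), (in_S_lin x) by (try apply in_S_apply'; assumption). reflexivity.
  - intros n Hn. exists (nrm n x * nrm n y).
    split; [apply Rmult_le_pos; apply nrm_pos|]. intros xi A HA.
    apply bnd_le with (nrm n x ^ 2 * (nrm n y ^ 2 * A)); [right; ring|].
    change (opmul x y xi) with (x (y xi)). apply op_bound; [assumption..|].
    apply bnd_w_mono with (wt n); [intros i; apply wt'_le_wt|].
    apply op_bound; assumption.
Qed.

Lemma in_S_opsum l : (forall x, In x l -> in_S x) -> in_S (opsum l).
Proof.
  induction l as [|x l IH]; intros H.
  - apply in_S_opzero.
  - apply in_S_opadd; [apply H; left; reflexivity|]. apply IH. intros y Hy. apply H. right. exact Hy.
Qed.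

(** Values off s' are arbitrary, so this is the equality of S. The adjoint chosen by [star] is
    determined only up to it. *)
Definition op_eq (x y : op) : Prop := forall xi, in_s' xi -> x xi = y xi.

Lemma opnorm_ext n x y : (1 <= n)%nat -> op_eq x y -> opnorm n x = opnorm n y.
Proof.
  intros Hn H. apply Lub_Rbar_eqset. intros r. split; intros (xi & Hb & Hr); exists xi;
    (split; [exact Hb|]);
    pose proof (H xi (ball_in_s' n xi Hn (proj1 (ball_s'_bnd n xi) Hb))) as E.
  - rewrite <- E. exact Hr.
  - rewrite E. exact Hr.
Qed.

(** * The adjoint *)

(* The matrix of the adjoint is the conjugate transpose: <x* xi, e_i> = <xi, x e_i>. *)
Definition adj (x : op) : op := fun xi i => pairing xi (x (basis i)).

Lemma pairing_zero_r xi : pairing xi (fun _ => RtoC 0) = RtoC 0.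
Proof.
  transitivity (CSeries (fun _ => RtoC 0)); [|apply CSeries_zero].
  apply CSeries_ext. intros i. apply injective_projections; simpl; ring.
Qed.

Lemma csum_adj x xi eta N : in_S x -> in_s' xi -> in_s' eta ->
  csum (fun i => adj x xi i * Cconj (eta i))%C N = pairing xi (x (trunc N eta)).
Proof.
  intros Hx Hxi Heta.
  assert (Hp : forall v, in_s' v -> pairable xi (x v)).
  { intros v Hv. apply pairable_sym, pairable_s_s'; [apply in_S_apply|]; assumption. }
  induction N as [|N IH].
  - rewrite csum_O, trunc_O, in_S_lin by auto using basis_in_s', in_s'_zero.
    rewrite pairing_lin_r by auto using basis_in_s', in_s'_zero.
    rewrite in_S_zero_vec by assumption.
    rewrite pairing_zero_r. unfold adj. ring.
  - rewrite csum_S, IH, trunc_S, in_S_lin by auto using basis_in_s', trunc_in_s'.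
    rewrite pairing_lin_r by auto using basis_in_s', trunc_in_s'.
    unfold adj. ring.
Qed.

Lemma common_bnd xi eta : in_s' xi -> in_s' eta ->
  exists n A B, (1 <= n)%nat /\ bnd (wt' n) xi A /\ bnd (wt' n) eta B.
Proof.
  rewrite !in_s'_bnd. intros (n & A & Hn & HA) (m & B & Hm & HB).
  exists (max n m), A, B. split; [lia|]. split.
  - apply bnd_w_mono with (2 := HA). intros i. apply wt'_mono. lia.
  - apply bnd_w_mono with (2 := HB). intros i. apply wt'_mono. lia.
Qed.

(** Here B is the sum of the series itself, so that tails measured against B tend to zero. *)
Lemma bnd_approx w xi A : (forall i, 0 < w i) -> bnd w xi A ->
  exists B, bnd w xi B /\ forall eps, 0 < eps ->
    exists N, forall M, (N <= M)%nat ->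
      B - sum_n (fun i => Cmod (xi i) ^ 2 * w i) M <= eps.
Proof.
  intros Hw HA. set (a := fun i => Cmod (xi i) ^ 2 * w i).
  assert (Ha : forall i, 0 <= a i) by (intros i; apply term_pos, Hw).
  assert (He : ex_series a) by (apply ex_series_bounded with A; assumption).
  exists (Series a). split.
  - intros N. apply sum_n_le_Series; assumption.
  - intros eps Heps. apply Series_correct in He.
    assert (Hl : is_lim_seq (sum_n a) (Series a)) by exact He.
    apply is_lim_seq_Reals in Hl. destruct (Hl eps Heps) as [N HN].
    exists N. intros M HM. specialize (HN M HM). unfold R_dist in HN.
    apply Rabs_def2 in HN. lra.
Qed.

(** For a truncated eta the identity is linearity ([csum_adj]); the error is the pairing of xi with
    x applied to the tail, and continuity of x from |.|_n' to |.|_n makes it small. *)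
Lemma adj_pairing x xi eta : in_S x -> in_s' xi -> in_s' eta ->
  pairing (adj x xi) eta = pairing xi (x eta).
Proof.
  intros Hx Hxi Heta. apply CSeries_limit. intros eps Heps.
  destruct (common_bnd xi eta Hxi Heta) as (n & A & B0 & Hn & HA & HB0).
  destruct (bnd_approx (wt' n) eta B0 (wt'_pos n) HB0) as (B & HB & Happ).
  set (c := sqrt A * nrm n x). assert (Hc : 0 <= c) by (apply Rmult_le_pos; [apply sqrt_pos|apply nrm_pos]).
  set (d := (eps / (c + 1))). assert (Hd : 0 < d) by (apply Rdiv_lt_0_compat; lra).
  destruct (Happ (d ^ 2)) as [N HN]; [apply pow_lt; exact Hd|].
  exists N. intros M HM. specialize (HN M HM).
  rewrite csum_adj by assumption.
  set (tl := fun i => (eta i - trunc M eta i)%C).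
  assert (Htl : bnd (wt' n) tl (d ^ 2)).
  { apply bnd_le with (1 := HN). apply bnd_tail; [apply wt'_pos|exact HB]. }
  assert (Htl' : in_s' tl) by (apply in_s'_bnd; exists n, (d ^ 2); split; assumption).
  assert (E : eta = (fun j => 1 * trunc M eta j + tl j)%C)
    by (apply functional_extensionality; intros j; unfold tl; ring).
  assert (Hp : forall v, in_s' v -> pairable xi (x v)).
  { intros v Hv. apply pairable_sym, pairable_s_s'; [apply in_S_apply|]; assumption. }
  rewrite E at 2. rewrite in_S_lin by auto using trunc_in_s'.
  rewrite pairing_lin_r by auto using trunc_in_s'.
  replace (pairing xi (x (trunc M eta)) -
     (Cconj 1 * pairing xi (x (trunc M eta)) + pairing xi (x tl)))%C
    with (- pairing xi (x tl))%C
    by (replace (Cconj 1) with (RtoC 1) by (apply injective_projections; simpl; ring); ring).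
  rewrite Cmod_opp.
  apply Rle_trans with (sqrt A * sqrt (nrm n x ^ 2 * d ^ 2)).
  - apply (pairing_CS (wt' n) (wt n)); auto using wt'_pos, wt'_inv, op_bound.
  - rewrite <- Rpow_mult_distr, sqrt_pow2 by (apply Rmult_le_pos; [apply nrm_pos|lra]).
    rewrite <- Rmult_assoc. fold c.
    assert (d * (c + 1) = eps) by (unfold d; field; lra). nra.
Qed.

(* Test vectors of the form v_i w_i, cut off, realise the norm of v by duality. *)
Lemma dual_bound n v T : (1 <= n)%nat -> 0 <= T ->
  (forall eta, bnd (wt' n) eta 1 -> Cmod (pairing v eta) <= T) ->
  bnd (wt n) v (T ^ 2).
Proof.
  intros Hn HT H N.
  set (s := sum_n (fun i => Cmod (v i) ^ 2 * wt n i) N).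
  assert (Hs : 0 <= s) by (apply sum_n_R_pos; intros i; apply term_pos, wt_pos).
  destruct (Rle_lt_or_eq_dec 0 s Hs) as [Hs'|<-]; [|apply pow2_ge_0].
  assert (Hr : 0 < sqrt s) by (apply sqrt_lt_R0; exact Hs').
  assert (Hrr : sqrt s * sqrt s = s) by (apply sqrt_sqrt; lra).
  set (c := (/ sqrt s)).
  set (eta := fun i => (c * trunc N (fun j => wt n j * v j) i)%C).
  assert (Ec : c ^ 2 * s = 1) by (unfold c; rewrite <- Hrr at 2; field; lra).
  assert (Heta : bnd (wt' n) eta 1).
  { apply bnd_le with (Cmod c ^ 2 * sum_n (fun i => Cmod (wt n i * v i) ^ 2 * wt' n i) N).
    - rewrite Cmod_R, <- Rsqr_pow2, <- Rsqr_abs, Rsqr_pow2, <- Ec. right. f_equal.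
      apply sum_n_R_ext. intros i. rewrite Cmod_mult, Cmod_R, Rabs_pos_eq by (left; apply wt_pos).
      unfold wt'. pose proof (wt_pos n i). field. lra.
    - apply (bnd_scal _ _ _ (RtoC c)), bnd_trunc, wt'_pos. }
  apply H in Heta.
  assert (E : pairing v eta = RtoC (c * s)).
  { apply CSeries_limit. intros eps Heps. exists N. intros M HM.
    assert (E1 : csum (fun i => v i * Cconj (eta i))%C M = RtoC (c * s)).
    { assert (Et : forall i, (v i * Cconj (eta i))%C = 
         if le_dec i N then RtoC (c * (Cmod (v i) ^ 2 * wt n i)) else RtoC 0).
      { intros i. unfold eta, trunc. destruct (le_dec i N).
        - rewrite !Cmult_conj.
          replace (Cconj c) with (RtoC c) by (apply injective_projections; simpl; ring).
          replace (Cconj (wt n i)) with (RtoC (wt n i)) by (apply injective_projections; simpl; ring).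
          replace (v i * (c * (wt n i * Cconj (v i))))%C
            with (c * ((v i * Cconj (v i)) * wt n i))%C by ring.
          rewrite <- Cmod2_conj, <- !RtoC_mult. reflexivity.
        - apply injective_projections; simpl; ring. }
      replace (fun i => (v i * Cconj (eta i))%C) with
        (fun i => if le_dec i N then RtoC (c * (Cmod (v i) ^ 2 * wt n i)) else RtoC 0)
        by (apply functional_extensionality; intros i; symmetry; apply Et).
      clear - HM. induction HM as [|M HM IH].
      - unfold csum. apply injective_projections; simpl.
        + transitivity (sum_n (fun i => c * (Cmod (v i) ^ 2 * wt n i) + 0 * 0) N).
          * apply sum_n_R_ext_loc. intros i Hi. destruct (le_dec i N); [|lia]. simpl. ring.
          * rewrite (sum_n_R_lin c 0 _ (fun _ => 0)). unfold s. ring.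
        + transitivity (sum_n (fun i => 0 * 0 + 0 * 0) N).
          * apply sum_n_R_ext_loc. intros i Hi. destruct (le_dec i N); [|lia]. simpl. ring.
          * rewrite (sum_n_R_lin 0 0 (fun _ => 0) (fun _ => 0)). ring.
      - rewrite csum_S, IH. destruct (le_dec (S M) N); [lia|]. ring. }
    rewrite E1. replace (RtoC (c * s) - RtoC (c * s))%C with (RtoC 0) by ring.
    rewrite Cmod_0. lra. }
  rewrite E, Cmod_R in Heta.
  assert (Ecs : c * s = sqrt s) by (unfold c; rewrite <- Hrr at 2; field; lra).
  rewrite Ecs, Rabs_pos_eq in Heta by lra.
  rewrite <- Hrr. simpl. nra.
Qed.

Lemma adj_in_S x : in_S x -> in_S (adj x).
Proof.
  intros Hx. apply in_S_intro.
  - intros a xi eta Hxi Heta i. unfold adj.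
    apply pairing_lin_l; apply pairable_sym, pairable_s_s';
      auto using in_S_apply, basis_in_s'.
  - intros n Hn. exists (nrm n x). split; [apply nrm_pos|]. intros xi A HA.
    pose proof (bnd_pos _ _ _ (wt'_pos n) HA) as HA0.
    rewrite <- (pow2_sqrt A HA0), <- Rpow_mult_distr.
    apply dual_bound; [exact Hn|apply Rmult_le_pos; [apply nrm_pos|apply sqrt_pos]|].
    intros eta Heta.
    rewrite adj_pairing; [|assumption|apply in_s'_bnd; exists n, A; split; assumption
                          |apply ball_in_s' with n; assumption].
    apply Rle_trans with (sqrt A * sqrt (nrm n x ^ 2 * 1)).
    + apply (pairing_CS (wt' n) (wt n)); auto using wt'_pos, wt'_inv, op_bound.
    + rewrite Rmult_1_r, sqrt_pow2 by apply nrm_pos. lra.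
Qed.

Lemma star_spec x : in_S x -> is_adjoint x (star x).
Proof.
  intros Hx. apply (epsilon_spec (inhabits opzero) (is_adjoint x)). exists (adj x). split.
  - apply adj_in_S, Hx.
  - intros. apply adj_pairing; assumption.
Qed.

Lemma star_in_S x : in_S x -> in_S (star x).
Proof. intros Hx. apply (star_spec x Hx). Qed.

Lemma star_pairing x xi eta : in_S x -> in_s' xi -> in_s' eta ->
  pairing (star x xi) eta = pairing xi (x eta).
Proof. intros Hx. apply (star_spec x Hx). Qed.

(** Pairing with coordinate vectors recovers every coordinate, so whichever adjoint [epsilon] picks
    agrees with the matrix formula on s'. *)
Lemma star_adj x : in_S x -> op_eq (star x) (adj x).
Proof.
  intros Hx xi Hxi. apply functional_extensionality. intros i.
  rewrite <- (pairing_basis_r (star x xi) i). apply star_pairing; auto using basis_in_s'.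
Qed.

Lemma star_star x : in_S x -> op_eq (star (star x)) x.
Proof.
  intros Hx xi Hxi. rewrite (star_adj (star x) (star_in_S x Hx) xi Hxi).
  apply functional_extensionality. intros i. unfold adj.
  rewrite pairing_conj, star_pairing by auto using basis_in_s'.
  rewrite <- pairing_conj. apply pairing_basis_r.
Qed.

Lemma star_lincomb (a : C) x y : in_S x -> in_S y ->
  op_eq (star (opadd (opscal a x) y)) (opadd (opscal (Cconj a) (star x)) (star y)).
Proof.
  intros Hx Hy xi Hxi. rewrite (star_adj _ (in_S_lincomb a x y Hx Hy) xi Hxi).
  apply functional_extensionality. intros i. unfold opadd, opscal.
  rewrite (star_adj x Hx xi Hxi), (star_adj y Hy xi Hxi). unfold adj.
  apply pairing_lin_r; apply pairable_sym, pairable_s_s'; auto using in_S_apply, basis_in_s'.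
Qed.

Lemma star_opzero : op_eq (star opzero) opzero.
Proof.
  intros xi Hxi. rewrite (star_adj _ in_S_opzero xi Hxi).
  apply functional_extensionality. intros i. apply pairing_zero_r.
Qed.

Lemma star_opscal (a : C) x : in_S x -> op_eq (star (opscal a x)) (opscal (Cconj a) (star x)).
Proof.
  intros Hx xi Hxi. rewrite opscal_zero, star_lincomb by auto using in_S_opzero.
  unfold opadd. rewrite star_opzero by exact Hxi.
  apply functional_extensionality. intros i. unfold opscal, opzero. ring.
Qed.

(** The pairing of |.|_n against |.|_n' is contractive, so no constant is lost; the bound M^2 in
    [uform_bilnorm] relies on this. *)
Lemma star_nrm n x : in_S x -> (1 <= n)%nat -> nrm n (star x) <= nrm n x.
Proof.
  intros Hx Hn. apply nrm_le; auto using star_in_S, nrm_pos.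
  intros xi Hxi. apply dual_bound; [exact Hn|apply nrm_pos|].
  intros eta Heta.
  rewrite star_pairing; [|assumption|apply ball_in_s' with n; assumption..].
  apply Rle_trans with (sqrt 1 * sqrt (nrm n x ^ 2 * 1)).
  - apply (pairing_CS (wt' n) (wt n)); auto using wt'_pos, wt'_inv, op_bound.
  - rewrite Rmult_1_r, sqrt_pow2, sqrt_1 by apply nrm_pos. lra.
Qed.

(** * Gram operators and vector states *)

Definition lsum {X : Type} (f : X -> R) (l : list X) : R := fold_right (fun x s => f x + s) 0 l.

Lemma lsum_cons {X} (f : X -> R) x l : lsum f (x :: l) = f x + lsum f l.
Proof. reflexivity. Qed.

Lemma lsum_le {X} (f g : X -> R) l : (forall x, In x l -> f x <= g x) -> lsum f l <= lsum g l.
Proof.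
  induction l as [|x l IH]; intros H; simpl; [lra|].
  specialize (IH (fun y Hy => H y (or_intror Hy))). specialize (H x (or_introl eq_refl)). lra.
Qed.

Lemma lsum_ext {X} (f g : X -> R) l : (forall x, In x l -> f x = g x) -> lsum f l = lsum g l.
Proof. intros H. apply Rle_antisym; apply lsum_le; intros x Hx; rewrite (H x Hx); lra. Qed.

Lemma lsum_lin {X} (c d : R) (f g : X -> R) l :
  lsum (fun x => c * f x + d * g x) l = c * lsum f l + d * lsum g l.
Proof. induction l as [|x l IH]; simpl; [ring|]. rewrite IH. ring. Qed.

Lemma lsum_map {X Y} (h : X -> Y) (f : Y -> R) l : lsum f (map h l) = lsum (fun x => f (h x)) l.
Proof. induction l as [|x l IH]; simpl; [reflexivity|]. rewrite IH. reflexivity. Qed.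

Lemma lsum_pos {X} (f : X -> R) l : (forall x, In x l -> 0 <= f x) -> 0 <= lsum f l.
Proof.
  intros H. apply Rle_trans with (lsum (fun _ => 0) l).
  - right. clear. induction l; simpl; lra.
  - apply lsum_le. exact H.
Qed.

Lemma lsum_app {X} (f : X -> R) (l1 l2 : list X) : lsum f (l1 ++ l2) = lsum f l1 + lsum f l2.
Proof. induction l1 as [|x l1 IH]; simpl; [ring|]. rewrite IH. ring. Qed.

(** The squared l2 length of x xi, which is <x* x xi, xi> with the involution removed;
    [phi_vec_star_mul] makes the link. *)
Definition qf (x : op) (xi : cseq) : R := Re (pairing (x xi) (x xi)).

Lemma pairing_self v : in_s v ->
  pairing v v = RtoC (Series (fun i => Cmod (v i) ^ 2)) /\ ex_series (fun i => Cmod (v i) ^ 2).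
Proof.
  intros Hv. split.
  - transitivity (CSeries (fun i => RtoC (Cmod (v i) ^ 2))).
    + apply CSeries_ext. intros i. rewrite Cmod2_conj. reflexivity.
    + apply injective_projections; [reflexivity|].
      change (Series (fun _ => 0) = 0). rewrite (Series_ext _ (fun _ => 0 * 0)) by (intros; ring).
      rewrite Series_scal_l. ring.
  - apply ex_series_ext with (2 := pairable_s_s' v v Hv (in_s_in_s' v Hv)).
    intros i. rewrite Cmod_mult, Cmod_conj. simpl. rewrite Rmult_1_r. reflexivity.
Qed.

Lemma pairing_self_re v : in_s v -> pairing v v = RtoC (Re (pairing v v)).
Proof. intros Hv. destruct (pairing_self v Hv) as [E _]. rewrite E. reflexivity. Qed.

Lemma pairing_self_pos v : in_s v -> 0 <= Re (pairing v v).
Proof.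
  intros Hv. destruct (pairing_self v Hv) as [E H]. rewrite E. simpl.
  apply Rle_trans with (2 := sum_n_le_Series _ O (fun i => pow2_ge_0 _) H).
  rewrite sum_n_R_O. apply pow2_ge_0.
Qed.

Lemma pairing_self_zero v : in_s v -> Re (pairing v v) = 0 -> forall i, v i = RtoC 0.
Proof.
  intros Hv H0 i. destruct (pairing_self v Hv) as [E H]. rewrite E in H0. simpl in H0.
  assert (Hi : Cmod (v i) ^ 2 <= 0).
  { rewrite <- H0. apply Rle_trans with (2 := sum_n_le_Series _ i (fun i => pow2_ge_0 _) H).
    apply (term_le_sum_n (fun i => Cmod (v i) ^ 2)); auto. intros j. apply pow2_ge_0. }
  apply Cmod_eq_0. pose proof (Cmod_ge_0 (v i)). nra.
Qed.

Lemma qf_pos x xi : in_S x -> in_s' xi -> 0 <= qf x xi.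
Proof. intros. apply pairing_self_pos, in_S_apply; assumption. Qed.

Lemma pairing_expand (c : C) v w : in_s v -> in_s w ->
  Re (pairing (fun i => c * v i + w i)%C (fun i => c * v i + w i)%C)
  = Cmod c ^ 2 * Re (pairing v v) + 2 * Re (c * pairing v w)%C + Re (pairing w w).
Proof.
  intros Hv Hw. pose proof (in_s_in_s' v Hv) as Hv'. pose proof (in_s_in_s' w Hw) as Hw'.
  pose proof (in_s'_lin c v w Hv' Hw') as Hcv.
  rewrite pairing_lin_l by (apply pairable_s_s'; assumption).
  rewrite !pairing_lin_r by (apply pairable_s_s'; assumption).
  rewrite (pairing_conj v w), (pairing_self_re v Hv), (pairing_self_re w Hw).
  rewrite Cmod2_alt. unfold Re, Im. simpl. ring.
Qed.

(** Expand the squared length of w - c v, where the phase c turns <v, w> into its modulus. The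
    arithmetic mean, unlike the geometric one, adds up over a family of operators, as [nrm_gram]
    requires. *)
Lemma qf_polar x xi eta : in_S x -> in_s' xi -> in_s' eta ->
  Cmod (pairing (x xi) (x eta)) <= (qf x xi + qf x eta) / 2.
Proof.
  intros Hx Hxi Heta. unfold qf.
  pose proof (in_S_apply x xi Hx Hxi) as Hv. pose proof (in_S_apply x eta Hx Heta) as Hw.
  set (v := x xi) in *. set (w := x eta) in *.
  destruct (phase_spec (pairing v w)) as [H1 H2]. set (c := phase (pairing v w)) in *.
  pose proof (pairing_expand (- c)%C v w Hv Hw) as E.
  assert (Hp : in_s (fun i => - c * v i + w i)%C).
  { apply in_s_bnd. intros n Hn.
    destruct (proj1 (in_s_bnd v) Hv n Hn) as [A HA]. destruct (proj1 (in_s_bnd w) Hw n Hn) as [B HB].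
    exists (2 * (Cmod (- c)%C ^ 2 * A) + 2 * B).
    apply (bnd_plus _ (fun i => - c * v i)%C); [apply wt_pos|apply bnd_scal|]; assumption. }
  pose proof (pairing_self_pos _ Hp) as Hpos. rewrite E in Hpos.
  rewrite Cmod_opp, H1 in Hpos.
  replace (- c * pairing v w)%C with (- (c * pairing v w))%C in Hpos by ring.
  rewrite H2 in Hpos. change (Re (- RtoC (Cmod (pairing v w)))%C) with (- Cmod (pairing v w)) in Hpos.
  lra.
Qed.

Lemma phi_vec_star_mul x xi : in_S x -> in_s' xi ->
  phi_vec xi (opmul (star x) x) = RtoC (qf x xi).
Proof.
  intros Hx Hxi. unfold phi_vec, opmul, qf.
  rewrite star_pairing by (auto using in_S_apply', star_in_S).
  apply pairing_self_re, in_S_apply; assumption.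
Qed.

Lemma phi_vec_mul_star x xi : in_S x -> in_s' xi ->
  phi_vec xi (opmul x (star x)) = RtoC (qf (star x) xi).
Proof.
  intros Hx Hxi. unfold phi_vec, opmul, qf.
  pose proof (star_in_S x Hx) as Hs.
  rewrite pairing_conj, <- star_pairing by (auto using in_S_apply', star_in_S).
  rewrite (pairing_self_re (star x xi)) by (apply in_S_apply; assumption).
  apply injective_projections; simpl; ring.
Qed.

Lemma phi_vec_lin xi (a : C) x y : in_s' xi -> in_S x -> in_S y ->
  phi_vec xi (opadd (opscal a x) y) = (a * phi_vec xi x + phi_vec xi y)%C.
Proof.
  intros Hxi Hx Hy. unfold phi_vec, opadd, opscal.
  apply pairing_lin_l; apply pairable_s_s'; auto using in_S_apply.
Qed.

Lemma phi_vec_bound p xi x : (1 <= p)%nat -> bnd (wt' p) xi 1 -> in_S x ->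
  Cmod (phi_vec xi x) <= nrm p x.
Proof.
  intros Hp Hxi Hx. apply Rle_trans with (sqrt (nrm p x ^ 2) * sqrt 1).
  - apply (pairing_CS (wt p) (wt' p)); auto using wt_pos, wt_inv, op_bound_ball.
  - rewrite sqrt_pow2, sqrt_1 by apply nrm_pos. lra.
Qed.

Lemma qf_opscal (a : C) x xi : in_S x -> in_s' xi ->
  qf (opscal a x) xi = Cmod a ^ 2 * qf x xi.
Proof.
  intros Hx Hxi. unfold qf, opscal.
  assert (Hz : in_s (fun _ => RtoC 0)).
  { rewrite <- (in_S_zero_vec x Hx). apply in_S_apply; auto using in_s'_zero. }
  pose proof (pairing_expand a (x xi) (fun _ => RtoC 0) (in_S_apply x xi Hx Hxi) Hz) as E.
  rewrite !pairing_zero_r in E.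
  replace (fun i => (a * x xi i + 0)%C) with (fun i => (a * x xi i)%C) in E
    by (apply functional_extensionality; intros; ring).
  rewrite E. unfold Re. simpl. ring.
Qed.

Lemma qf_op_eq x y xi : op_eq x y -> in_s' xi -> qf x xi = qf y xi.
Proof. intros H Hxi. unfold qf. rewrite (H xi Hxi). reflexivity. Qed.

Lemma qf_star_opscal (a : C) x xi : in_S x -> in_s' xi ->
  qf (star (opscal a x)) xi = Cmod a ^ 2 * qf (star x) xi.
Proof.
  intros Hx Hxi. rewrite (qf_op_eq _ _ xi (star_opscal a x Hx) Hxi).
  rewrite qf_opscal by auto using star_in_S. rewrite Cmod_conj. reflexivity.
Qed.

Lemma qf_bound p x xi : (1 <= p)%nat -> in_S x -> bnd (wt' p) xi 1 ->
  qf x xi <= nrm p (opmul (star x) x).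
Proof.
  intros Hp Hx Hxi. pose proof (ball_in_s' p xi Hp Hxi) as Hxi'.
  apply Rle_trans with (1 := Rle_abs _). rewrite <- Cmod_R, <- phi_vec_star_mul by assumption.
  apply phi_vec_bound; auto using in_S_opmul, star_in_S.
Qed.

(* A positive operator attains its norm on the diagonal: polarise <a xi, eta>. *)
Lemma nrm_gram p xs T : (1 <= p)%nat -> 0 <= T -> (forall x, In x xs -> in_S x) ->
  (forall xi, bnd (wt' p) xi 1 -> lsum (fun x => qf x xi) xs <= T) ->
  nrm p (opsum (map (fun x => opmul (star x) x) xs)) <= T.
Proof.
  intros Hp HT Hxs H.
  assert (HS : forall l, (forall x, In x l -> in_S x) ->
                 in_S (opsum (map (fun x => opmul (star x) x) l))).
  { intros l Hl. apply in_S_opsum. intros y Hy. apply in_map_iff in Hy.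
    destruct Hy as (x & <- & Hx). apply in_S_opmul; auto using star_in_S. }
  apply nrm_le; [apply HS, Hxs|exact Hp|exact HT|].
  intros xi Hxi. apply dual_bound; [exact Hp|exact HT|]. intros eta Heta.
  pose proof (ball_in_s' p xi Hp Hxi) as Hxi'. pose proof (ball_in_s' p eta Hp Heta) as Heta'.
  apply Rle_trans with ((lsum (fun x => qf x xi) xs + lsum (fun x => qf x eta) xs) / 2).
  - clear H. induction xs as [|x xs IH].
    + change (Cmod (pairing (fun _ => RtoC 0) eta) <= (0 + 0) / 2).
      rewrite pairing_conj, pairing_zero_r, Cmod_conj, Cmod_0. lra.
    + simpl.
      assert (Hx : in_S x) by (apply Hxs; left; reflexivity).
      assert (Hl : forall y, In y xs -> in_S y) by (intros y Hy; apply Hxs; right; exact Hy).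
      replace (opadd (opmul (star x) x) (opsum (map (fun x => opmul (star x) x) xs)) xi)
        with (fun i => 1 * star x (x xi) i + opsum (map (fun x => opmul (star x) x) xs) xi i)%C
        by (apply functional_extensionality; intros; unfold opadd, opmul; ring).
      rewrite pairing_lin_l.
      * rewrite star_pairing by (auto using in_S_apply', star_in_S).
        apply Rle_trans with (1 := Cmod_triangle _ _). rewrite Cmult_1_l.
        pose proof (qf_polar x xi eta Hx Hxi' Heta'). specialize (IH Hl). lra.
      * apply pairable_s_s'; auto using in_S_apply, in_S_apply', star_in_S.
      * apply pairable_s_s'; auto. apply in_S_apply; auto.
  - pose proof (H xi Hxi). pose proof (H eta Heta). lra.
Qed.

Lemma opsum_ext (f g : op -> op) xs :
  (forall x, In x xs -> op_eq (f x) (g x)) -> op_eq (opsum (map f xs)) (opsum (map g xs)).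
Proof.
  intros H xi Hxi. induction xs as [|x xs IH]; [reflexivity|].
  apply functional_extensionality. intros i. simpl. unfold opadd.
  rewrite (H x (or_introl eq_refl) xi Hxi), IH; [reflexivity|].
  intros y Hy. apply H. right. exact Hy.
Qed.

(** This is the Gram bound for the family x_j*, since x_j** = x_j on s' and the norm sees only
    values there. *)
Lemma nrm_cogram p xs T : (1 <= p)%nat -> 0 <= T -> (forall x, In x xs -> in_S x) ->
  (forall xi, bnd (wt' p) xi 1 -> lsum (fun x => qf (star x) xi) xs <= T) ->
  nrm p (opsum (map (fun x => opmul x (star x)) xs)) <= T.
Proof.
  intros Hp HT Hxs H. unfold nrm.
  rewrite (opnorm_ext p _ (opsum (map (fun x => opmul (star x) x) (map star xs)))).
  - apply nrm_gram; auto.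
    + intros y Hy. apply in_map_iff in Hy. destruct Hy as (x & <- & Hx). auto using star_in_S.
    + intros xi Hxi. rewrite lsum_map. auto.
  - exact Hp.
  - rewrite map_map. apply opsum_ext. intros x Hx xi Hxi. unfold opmul.
    symmetry. apply star_star; auto. apply in_S_apply'; auto using star_in_S.
Qed.

(** * The Frechet-Hilbert space *)

Section FH.
Variable H : FrechetHilbert.
Variable k : nat.
Notation ip := (FH_ip H k).
Notation N := (FH_norm H k).

Lemma ip_zero_l g : ip zero g = RtoC 0.
Proof.
  pose proof (FH_ip_lin H k 1%C zero zero g) as E.
  rewrite (@scal_zero_r C_Ring H), plus_zero_l in E.
  set (z := ip zero g) in *. transitivity (1 * z + z - z)%C; [ring|]. rewrite <- E. ring.
Qed.

Lemma ip_scal_l a h g : ip (scal a h) g = (a * ip h g)%C.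
Proof.
  pose proof (FH_ip_lin H k a h zero g) as E. rewrite plus_zero_r, ip_zero_l in E.
  rewrite E. ring.
Qed.

Lemma ip_self h : ip h h = RtoC (N h ^ 2).
Proof.
  unfold FH_norm. rewrite pow2_sqrt by apply FH_ip_pos.
  pose proof (FH_ip_herm H k h h) as E. apply (f_equal Im) in E. rewrite im_conj in E.
  apply injective_projections; [reflexivity|]. unfold Im in E. simpl. lra.
Qed.

Lemma ip_lin_r a g h1 h2 : ip g (plus (scal a h1) h2) = (Cconj a * ip g h1 + ip g h2)%C.
Proof.
  rewrite FH_ip_herm, FH_ip_lin, Cplus_conj, Cmult_conj, <- !FH_ip_herm. reflexivity.
Qed.

Lemma FH_norm_scal a h : N (scal a h) = Cmod a * N h.
Proof.
  unfold FH_norm at 1. rewrite ip_scal_l.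
  rewrite FH_ip_herm, ip_scal_l, Cmult_conj, <- FH_ip_herm, ip_self, Cmult_assoc, <- Cmod2_conj.
  rewrite <- RtoC_mult. change (sqrt (Cmod a ^ 2 * N h ^ 2) = Cmod a * N h).
  rewrite <- Rpow_mult_distr, sqrt_pow2; [reflexivity|].
  apply Rmult_le_pos; [apply Cmod_ge_0|apply sqrt_pos].
Qed.

Lemma FH_norm_pos h : 0 <= N h.
Proof. apply sqrt_pos. Qed.

Lemma ip_CS h g : Cmod (ip h g) <= N h * N g.
Proof.
  destruct (phase_spec (ip h g)) as [H1 H2]. set (c := phase (ip h g)) in *.
  set (R0 := Cmod (ip h g)) in *.
  assert (HR0 : 0 <= R0) by apply Cmod_ge_0.
  pose proof (FH_norm_pos h) as Ha. pose proof (FH_norm_pos g) as Hb.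
  (* The right side is the squared seminorm of c h - t g; the phase c turns the cross term into
     R0. *)
  assert (Hq : forall t : R, 0 <= N h ^ 2 - 2 * t * R0 + t ^ 2 * N g ^ 2).
  { intros t. set (f := plus (scal (RtoC (- t)) g) (scal c h)).
    pose proof (FH_ip_pos H k f) as Hpos. unfold f in Hpos.
    rewrite FH_ip_lin, ip_lin_r, ip_lin_r in Hpos.
    rewrite (ip_self (scal c h)), FH_norm_scal, H1, (ip_self g) in Hpos.
    rewrite (FH_ip_herm H k (scal c h) g) in Hpos.
    rewrite !ip_scal_l, H2 in Hpos. unfold Re in Hpos. simpl in Hpos. simpl. nra. }
  set (a := N h) in *. set (b := N g) in *. clearbody a b R0.
  (* A semi-inner product may degenerate at g; the inequality is then affine in t, and a large t
     forces R0 = 0. *)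
  destruct (Req_dec b 0) as [->|Hb0].
  - destruct (Req_dec R0 0) as [->|HR]; [lra|].
    specialize (Hq ((a ^ 2 + 1) / (2 * R0))).
    replace (2 * ((a ^ 2 + 1) / (2 * R0)) * R0) with (a ^ 2 + 1) in Hq by (field; exact HR).
    nra.
  - specialize (Hq (R0 / b ^ 2)).
    assert (Hbp : 0 < b ^ 2) by (apply pow_lt; lra).
    assert (E : a ^ 2 - 2 * (R0 / b ^ 2) * R0 + (R0 / b ^ 2) ^ 2 * b ^ 2 = (a ^ 2 * b ^ 2 - R0 ^ 2) / b ^ 2)
      by (field; exact Hb0).
    rewrite E in Hq.
    assert (0 <= a ^ 2 * b ^ 2 - R0 ^ 2).
    { apply Rnot_lt_le. intros Hlt. pose proof (Rdiv_neg_pos _ _ Hlt Hbp). lra. }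
    apply Rnot_lt_le. intros Hlt. assert (0 <= a * b) by (apply Rmult_le_pos; assumption). nra.
Qed.

Variable u : op -> H.
Hypothesis Hlin : lin_map H u.

Lemma u_opzero : u opzero = zero.
Proof.
  pose proof (Hlin 1%C opzero opzero in_S_opzero in_S_opzero) as E.
  rewrite <- (opscal_zero 1%C opzero) in E.
  replace (opscal 1%C opzero) with opzero in E
    by (do 2 (apply functional_extensionality; intros ?); unfold opscal, opzero; ring).
  rewrite (@scal_one C_Ring H (u opzero) : @scal C_Ring H (RtoC 1) (u opzero) = u opzero) in E.
  transitivity (plus (opp (u opzero)) (plus (u opzero) (u opzero))).
  - rewrite plus_assoc, plus_opp_l, plus_zero_l. reflexivity.
  - rewrite <- E. exact (@plus_opp_l H (u opzero)).
Qed.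

Lemma u_opscal a x : in_S x -> u (opscal a x) = scal a (u x).
Proof.
  intros Hx. rewrite opscal_zero, Hlin by (auto using in_S_opzero).
  rewrite u_opzero, plus_zero_r. reflexivity.
Qed.

End FH.

(** * The bilinear form attached to u and the inequality of K *)

Section Bound.
Variable H : FrechetHilbert.
Variable u : op -> H.
Hypothesis Hlin : lin_map H u.
Hypothesis Hcont : cont_map H u.

Lemma cont_map_nrm k : exists m c, (1 <= m)%nat /\ 0 <= c /\
  forall x, in_S x -> FH_norm H k (u x) <= c * nrm m x.
Proof.
  destruct (Hcont k) as (m & c & Hm & Hc). exists m, (Rmax c 0).
  split; [exact Hm|]. split; [apply Rmax_r|]. intros x Hx. specialize (Hc x Hx).
  rewrite (opnorm_nrm m x Hx Hm) in Hc. simpl in Hc.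
  apply Rle_trans with (1 := Hc). apply Rmult_le_compat_r; [apply nrm_pos|apply Rmax_l].
Qed.

(** [lin_map] speaks of representatives, so this needs an argument: the difference z has every norm
    0, hence u z has every seminorm 0 by continuity, and H is separated. *)
Lemma u_op_eq x y : in_S x -> in_S y -> op_eq x y -> u x = u y.
Proof.
  intros Hx Hy Hxy. set (z := opadd (opscal (-(1))%C x) y).
  assert (Ez : op_eq z opzero).
  { intros xi Hxi. apply functional_extensionality. intros i.
    unfold z, opadd, opscal, opzero. rewrite (Hxy xi Hxi). ring. }
  assert (Hz : in_S z) by (apply in_S_lincomb; assumption).
  assert (Uz : u z = zero).
  { apply FH_sep. intros k. destruct (cont_map_nrm k) as (m & c & Hm & Hc & Hb).
    specialize (Hb z Hz). unfold nrm in Hb. rewrite (opnorm_ext m z opzero Hm Ez) in Hb.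
    change (real (opnorm m opzero)) with (nrm m opzero) in Hb.
    rewrite nrm_opzero, Rmult_0_r in Hb by exact Hm.
    pose proof (FH_norm_pos H k (u z)) as Hp.
    rewrite ip_self. simpl. replace (FH_norm H k (u z)) with 0 by lra. ring. }
  unfold z in Uz. rewrite Hlin in Uz by assumption.
  rewrite (@scal_opp_l C_Ring H (RtoC 1) (u x) : @scal C_Ring H (-(1))%C (u x) = opp (@scal C_Ring H (RtoC 1) (u x))) in Uz.
  rewrite (@scal_one C_Ring H (u x) : @scal C_Ring H (RtoC 1) (u x) = u x) in Uz.
  transitivity (plus (u x) (plus (opp (u x)) (u y))).
  - symmetry. exact (eq_trans (f_equal (@plus H (u x)) Uz) (@plus_zero_r H (u x))).
  - exact (eq_trans (@plus_assoc H _ _ _) (eq_trans (f_equal (fun z => @plus H z (u y)) (@plus_opp_r H (u x))) (@plus_zero_l H (u y)))).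
Qed.

Variables n k : nat.
Hypothesis Hn : (1 <= n)%nat.

Lemma mapnorm_pos : Rbar_le (Finite 0) (mapnorm H n k u).
Proof.
  apply (proj1 (Lub_Rbar_correct _)). exists opzero. split; [apply in_S_opzero|]. split.
  - rewrite (opnorm_nrm n opzero in_S_opzero Hn), nrm_opzero by exact Hn. simpl. lra.
  - apply FH_norm_pos.
Qed.

Lemma mapnorm_bound M : mapnorm H n k u = Finite M ->
  forall x, in_S x -> FH_norm H k (u x) <= M * nrm n x.
Proof.
  intros HM x Hx. pose proof mapnorm_pos as HM0. rewrite HM in HM0. simpl in HM0.
  (* Scaling by 1/t with t > ||x||_n also covers ||x||_n = 0. *)
  assert (Hb : forall t, nrm n x < t -> FH_norm H k (u x) <= M * t).
  { intros t Ht. pose proof (nrm_pos n x) as Hp. assert (Ht0 : 0 < t) by lra.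
    assert (Hti : 0 < / t) by (apply Rinv_0_lt_compat; exact Ht0).
    assert (Hr : FH_norm H k (u (opscal (RtoC (/ t)) x)) <= M).
    { change (Rbar_le (Finite (FH_norm H k (u (opscal (RtoC (/ t)) x)))) (Finite M)).
      rewrite <- HM. apply (proj1 (Lub_Rbar_correct _)).
      exists (opscal (RtoC (/ t)) x). split; [apply in_S_opscal, Hx|]. split; [|apply Rle_refl].
      rewrite (opnorm_nrm n _ (in_S_opscal _ x Hx) Hn). simpl.
      apply Rle_trans with (1 := nrm_opscal n _ x Hx Hn).
      rewrite Cmod_R, Rabs_pos_eq by lra.
      apply Rmult_le_reg_l with t; [exact Ht0|]. field_simplify; lra. }
    rewrite (u_opscal H u Hlin), FH_norm_scal, Cmod_R, Rabs_pos_eq in Hr by (try assumption; lra).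
    apply Rmult_le_compat_l with (r := t) in Hr; [|lra].
    rewrite <- Rmult_assoc, Rinv_r, Rmult_1_l in Hr by lra. lra. }
  apply le_epsilon. intros eps Heps.
  assert (Hd : 0 < eps / (M + 1)) by (apply Rdiv_lt_0_compat; lra).
  apply Rle_trans with (1 := Hb (nrm n x + eps / (M + 1)) ltac:(lra)).
  assert (eps / (M + 1) * (M + 1) = eps) by (field; lra). nra.
Qed.

(** The inner product is conjugate linear in its second argument, and so is the involution; together
    they give a bilinear form. *)
Definition uform (x y : op) : C := FH_ip H k (u x) (u (star y)).

Lemma uform_bilin : bilin_S uform.
Proof.
  split.
  - intros a x1 x2 y H1 H2 Hy. unfold uform. rewrite Hlin by assumption. apply FH_ip_lin.
  - intros a x y1 y2 Hx H1 H2. unfold uform.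
    assert (E : u (star (opadd (opscal a y1) y2))
                = u (opadd (opscal (Cconj a) (star y1)) (star y2))).
    { apply u_op_eq; auto using star_in_S, in_S_lincomb, star_lincomb. }
    rewrite E, Hlin, ip_lin_r, Cconj_conj by auto using star_in_S. reflexivity.
Qed.

Lemma uform_cont : cont_bilin_S uform.
Proof.
  destruct (cont_map_nrm k) as (m & c & Hm & Hc & Hb). exists m, (c * c). split; [exact Hm|].
  intros x y Hx Hy. rewrite (opnorm_nrm m x Hx Hm), (opnorm_nrm m y Hy Hm). simpl.
  apply Rle_trans with (1 := ip_CS H k _ _).
  pose proof (Hb x Hx) as H1. pose proof (Hb (star y) (star_in_S y Hy)) as H2.
  pose proof (star_nrm m y Hy Hm) as H3.
  pose proof (FH_norm_pos H k (u x)). pose proof (FH_norm_pos H k (u (star y))).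
  apply Rle_trans with ((c * nrm m x) * (c * nrm m y)); [|right; ring].
  apply Rmult_le_compat; try assumption.
  apply Rle_trans with (1 := H2). apply Rmult_le_compat_l; assumption.
Qed.

Lemma uform_bilnorm M : mapnorm H n k u = Finite M ->
  exists b, bilnorm n uform = Finite b /\ 0 <= b <= M ^ 2.
Proof.
  intros HM. pose proof (mapnorm_bound M HM) as Hb.
  pose proof mapnorm_pos as HM0. rewrite HM in HM0. simpl in HM0.
  assert (Hle : Rbar_le (bilnorm n uform) (Finite (M ^ 2))).
  { apply (proj2 (Lub_Rbar_correct _)). intros r (x & y & Hx & Hy & Hnx & Hny & Hr). simpl.
    rewrite (opnorm_nrm n x Hx Hn) in Hnx. rewrite (opnorm_nrm n y Hy Hn) in Hny. simpl in *.
    apply Rle_trans with (1 := Hr). apply Rle_trans with (1 := ip_CS H k _ _).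
    pose proof (Hb x Hx) as H1. pose proof (Hb (star y) (star_in_S y Hy)) as H2.
    pose proof (star_nrm n y Hy Hn) as H3. pose proof (nrm_pos n x). pose proof (nrm_pos n (star y)).
    pose proof (FH_norm_pos H k (u x)). pose proof (FH_norm_pos H k (u (star y))).
    apply Rmult_le_compat; try assumption; [nra|rewrite Rmult_1_r; nra]. }
  assert (Hge : Rbar_le (Finite 0) (bilnorm n uform)).
  { apply (proj1 (Lub_Rbar_correct _)). exists opzero, opzero.
    rewrite (opnorm_nrm n opzero in_S_opzero Hn), nrm_opzero by exact Hn.
    repeat split; try apply in_S_opzero; try (simpl; lra). apply Cmod_ge_0. }
  destruct (bilnorm n uform) as [b| |]; simpl in *; [|contradiction|contradiction].
  exists b. split; [reflexivity|]. split; assumption.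
Qed.

Lemma Kconst_n_le K : Kconst = Finite K -> exists Kn, Kconst_n n = Finite Kn /\ 0 <= Kn <= K.
Proof.
  intros HK.
  assert (H0 : Rbar_le (Finite 0) (Kconst_n n)).
  { apply (proj2 (Glb_Rbar_correct _)). intros c (Hc & _). exact Hc. }
  assert (Hle : forall r : R, Rbar_le (Finite r) (Kconst_n n) -> r <= K).
  { intros r Hr. change (Rbar_le (Finite r) (Finite K)). rewrite <- HK.
    apply (proj1 (Lub_Rbar_correct _)). exists n. split; assumption. }
  destruct (Kconst_n n) as [Kn| |].
  - exists Kn. split; [reflexivity|]. split; [exact H0|]. apply Hle. apply Rbar_le_refl.
  - specialize (Hle (K + 1) I). lra.
  - destruct H0.
Qed.

Lemma rcnorm_le xs T : (forall x, In x xs -> in_S x) -> 0 <= T ->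
  nrm (2 * n + 1) (opsum (map (fun x => opmul (star x) x) xs)) <= T ->
  nrm (2 * n + 1) (opsum (map (fun x => opmul x (star x)) xs)) <= T ->
  exists r, rcnorm (2 * n + 1) xs = Finite r /\ 0 <= r <= sqrt T.
Proof.
  intros Hxs HT H1 H2. unfold rcnorm.
  assert (HS1 : in_S (opsum (map (fun x => opmul (star x) x) xs))).
  { apply in_S_opsum. intros y Hy. apply in_map_iff in Hy.
    destruct Hy as (x & <- & Hx). auto using in_S_opmul, star_in_S. }
  assert (HS2 : in_S (opsum (map (fun x => opmul x (star x)) xs))).
  { apply in_S_opsum. intros y Hy. apply in_map_iff in Hy.
    destruct Hy as (x & <- & Hx). auto using in_S_opmul, star_in_S. }
  rewrite (opnorm_nrm _ _ HS1), (opnorm_nrm _ _ HS2) by lia.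
  unfold Rbar_maxi. simpl Rbar_sqrt.
  match goal with |- context [if ?b then _ else _] => destruct b end;
    (eexists; split; [reflexivity|]; split; [apply sqrt_pos|apply sqrt_le_1_alt; assumption]).
Qed.

(* The defining inequality of K, applied to (x, y) |-> <u x, u y*> and the pairs (x_j, x_j* ). *)
Lemma sum_u_le K M xs T : Kconst = Finite K -> mapnorm H n k u = Finite M ->
  (forall x, In x xs -> in_S x) -> 0 <= T ->
  (forall xi, bnd (wt' (2 * n + 1)) xi 1 -> lsum (fun x => qf x xi) xs <= T) ->
  (forall xi, bnd (wt' (2 * n + 1)) xi 1 -> lsum (fun x => qf (star x) xi) xs <= T) ->
  lsum (fun x => FH_norm H k (u x) ^ 2) xs <= K * M ^ 2 * T.
Proof.
  intros HK HM Hxs HT H1 H2.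
  destruct (Kconst_n_le K HK) as (Kn & HKn & HKn0).
  destruct (uform_bilnorm M HM) as (b & Hbl & Hb).
  assert (Hp : (1 <= 2 * n + 1)%nat) by lia.
  assert (Hsxs : forall x, In x (map star xs) -> in_S x).
  { intros y Hy. apply in_map_iff in Hy. destruct Hy as (x & <- & Hx). auto using star_in_S. }
  destruct (rcnorm_le xs T) as (r1 & Hr1 & Hr1'); auto using nrm_gram, nrm_cogram.
  (* Passing to the x_j* exchanges the two sums in ||.||^rc, so the same T serves the second
     family. *)
  destruct (rcnorm_le (map star xs) T) as (r2 & Hr2 & Hr2'); auto.
  { apply nrm_gram; auto. intros xi Hxi. rewrite lsum_map. auto. }
  { apply nrm_cogram; auto. intros xi Hxi. rewrite lsum_map.
    apply Rle_trans with (2 := H1 xi Hxi). right. apply lsum_ext. intros x Hx.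
    apply qf_op_eq; [apply star_star; auto|apply ball_in_s' with (2 * n + 1)%nat; assumption]. }
  set (ps := map (fun x => (x, star x)) xs).
  assert (Hf : map fst ps = xs) by (unfold ps; rewrite map_map; apply map_id).
  assert (Hs : map snd ps = map star xs) by (unfold ps; rewrite map_map; reflexivity).
  assert (Hps : forall p, In p ps -> in_S (fst p) /\ in_S (snd p)).
  { intros p Hin. apply in_map_iff in Hin. destruct Hin as (x & <- & Hx). simpl.
    auto using star_in_S. }
  assert (Hsum : Csum (map (fun p => uform (fst p) (snd p)) ps)
                 = RtoC (lsum (fun x => FH_norm H k (u x) ^ 2) xs)).
  { unfold ps. rewrite map_map. clear - Hxs Hlin Hcont.
    induction xs as [|x xs IH]; [reflexivity|]. simpl.
    rewrite RtoC_plus. f_equal.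
    - unfold uform. simpl.
      assert (Hx : in_S x) by (apply Hxs; left; reflexivity).
      (* The involution of the form cancels the one in the pair, leaving <u x, u x>_k. *)
      rewrite (u_op_eq (star (star x)) x) by auto using star_in_S, star_star.
      rewrite ip_self. reflexivity.
    - apply IH. intros y Hy. apply Hxs. right. exact Hy. }
  set (L := lsum (fun x => FH_norm H k (u x) ^ 2) xs) in *.
  set (Q := b * (r1 * r2)).
  assert (HQ0 : 0 <= Q) by (unfold Q; repeat apply Rmult_le_pos; lra).
  assert (Hc : forall c, Kn < c -> L <= c * Q).
  { intros c Hc.
    (* Some admissible c' lies below any c above the infimum [Kn]; otherwise c would be a lower
       bound. *)
    destruct (classic (exists c', c' < c /\ 0 <= c' /\
      forall v, bilin_S v -> cont_bilin_S v ->
      forall ps, (forall p, In p ps -> in_S (fst p) /\ in_S (snd p)) ->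
      Rbar_le (Finite (Cmod (Csum (map (fun p => v (fst p) (snd p)) ps))))
        (Rbar_mult (Finite c') (Rbar_mult (bilnorm n v)
            (Rbar_mult (rcnorm (2*n+1) (map fst ps)) (rcnorm (2*n+1) (map snd ps)))))))
      as [(c' & Hcc & Hc0 & Hc')|Hno].
    - specialize (Hc' uform uform_bilin uform_cont ps Hps).
      rewrite Hsum, Hf, Hs, Hbl, Hr1, Hr2, Cmod_R in Hc'. simpl in Hc'. fold Q in Hc'.
      apply Rle_trans with (1 := Rle_abs _). apply Rle_trans with (1 := Hc'). 
      apply Rmult_le_compat_r; lra.
    - exfalso. assert (Hge : Rbar_le (Finite c) (Kconst_n n)).
      { apply (proj2 (Glb_Rbar_correct _)). intros c' (Hc0 & Hc'). simpl.
        apply Rnot_lt_le. intros Hlt. apply Hno. exists c'. auto. }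
      rewrite HKn in Hge. simpl in Hge. lra. }
  assert (HL : L <= Kn * Q).
  { apply le_epsilon. intros eps Heps.
    assert (Hd : 0 < eps / (Q + 1)) by (apply Rdiv_lt_0_compat; lra).
    apply Rle_trans with (1 := Hc (Kn + eps / (Q + 1)) ltac:(lra)).
    assert (eps / (Q + 1) * (Q + 1) = eps) by (field; lra). nra. }
  apply Rle_trans with (1 := HL). rewrite Rmult_assoc.
  apply Rmult_le_compat; try lra. unfold Q.
  apply Rmult_le_compat; try lra; [apply Rmult_le_pos; lra|].
  rewrite <- (sqrt_sqrt T HT). apply Rmult_le_compat; lra.
Qed.

End Bound.

Lemma fun_choice {A B : Type} (Rel : A -> B -> Prop) :
  (forall a, exists b, Rel a b) -> exists f : A -> B, forall a, Rel a (f a).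
Proof.
  intros H. exists (fun a => proj1_sig (constructive_indefinite_description _ (H a))).
  intros a. apply proj2_sig.
Qed.

(** * A minimax principle *)

Definition negpart (s : R) : R := Rmax 0 (- s).

(** A second-order Taylor estimate: the squared negative part has derivative -2 [negpart s], which
    is 2-Lipschitz in s. *)
Lemma negpart_sq_step s v : negpart (s + v) ^ 2 <= negpart s ^ 2 - 2 * negpart s * v + v ^ 2.
Proof.
  unfold negpart, Rmax.
  destruct (Rle_dec 0 (- (s + v))), (Rle_dec 0 (- s)); nra.
Qed.

(* Descent for the penalty sum_x negpart (f x om)^2: its current residuals serve as multipliers,
   and moving slightly towards a good point for these multipliers lowers the penalty by a fixed amount. *)
Lemma finite_minimax {X Om : Type} (P : Om -> Prop) (f : X -> Om -> R) (D : X -> R) (xs : list X) :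
  (exists om, P om) ->
  (forall x om, In x xs -> P om -> Rabs (f x om) <= D x) ->
  (forall om om' t, P om -> P om' -> 0 <= t <= 1 ->
     exists om'', P om'' /\ forall x, In x xs -> f x om'' = (1 - t) * f x om + t * f x om') ->
  (forall lam : X -> R, (forall x, 0 <= lam x) -> forall delta, 0 < delta ->
     exists om, P om /\ - delta <= lsum (fun x => lam x * f x om) xs) ->
  forall eps, 0 < eps -> exists om, P om /\ forall x, In x xs -> - eps <= f x om.
Proof.
  intros [om0 H0] HD Hmix Hdual eps Heps.
  set (G := fun om => lsum (fun x => negpart (f x om) ^ 2) xs).
  assert (HG : forall om, 0 <= G om) by (intros om; apply lsum_pos; intros x _; apply pow2_ge_0).
  (* A penalty of at most eps^2 forces every single residual to be at most eps. *)
  set (eta := eps ^ 2). assert (Heta : 0 < eta) by (apply pow_lt; exact Heps).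
  (* Bounds the sum of squared increments of f between two points of P; the added [eta] keeps S
     positive and the step length t at most 1. *)
  set (S := lsum (fun x => (2 * D x) ^ 2) xs + eta).
  assert (HS : eta <= S).
  { unfold S. pose proof (lsum_pos (fun x => (2 * D x) ^ 2) xs (fun x _ => pow2_ge_0 _)). lra. }
  set (c := eta ^ 2 / (4 * S)).
  assert (Hc : 0 < c) by (apply Rdiv_lt_0_compat; [apply pow_lt|]; lra).
  assert (Hstep : forall om, P om -> eta < G om -> exists om', P om' /\ G om' <= G om - c).
  { intros om Hom HGom.
    destruct (Hdual (fun x => negpart (f x om)) (fun x => Rmax_l _ _) (eta / 2)) as (om' & Hom' & Hsum);
      [lra|].
    (* This t maximises the guaranteed decrease t eta - t^2 S, and the maximum is c. *)
    set (t := eta / (2 * S)).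
    assert (Ht : 0 <= t <= 1).
    { split; [left; apply Rdiv_lt_0_compat; lra|].
      apply Rmult_le_reg_r with (2 * S); [lra|]. unfold t. field_simplify; lra. }
    destruct (Hmix om om' t Hom Hom' Ht) as (om'' & Hom'' & Hf).
    exists om''. split; [exact Hom''|].
    assert (H1 : G om'' <= G om - 2 * t * lsum (fun x => negpart (f x om) * (f x om' - f x om)) xs
              + t ^ 2 * lsum (fun x => (f x om' - f x om) ^ 2) xs).
    { unfold G.
      replace (lsum (fun x => negpart (f x om) ^ 2) xs
        - 2 * t * lsum (fun x => negpart (f x om) * (f x om' - f x om)) xs
        + t ^ 2 * lsum (fun x => (f x om' - f x om) ^ 2) xs)
      with (lsum (fun x => 1 * (1 * (negpart (f x om) ^ 2)
              + (- (2 * t)) * (negpart (f x om) * (f x om' - f x om)))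
              + t ^ 2 * (f x om' - f x om) ^ 2) xs)
        by (rewrite !lsum_lin; ring).
      apply lsum_le. intros x Hx. rewrite (Hf x Hx).
      replace ((1 - t) * f x om + t * f x om') with (f x om + t * (f x om' - f x om)) by ring.
      apply Rle_trans with (1 := negpart_sq_step _ _). right. ring. }
    (* Since s times [negpart s] is minus the square of [negpart s], the first-order term splits
       into the multiplier sum, which is at least -eta/2, and G om, which exceeds eta. *)
    assert (H2 : lsum (fun x => negpart (f x om) * (f x om' - f x om)) xs
                 = lsum (fun x => negpart (f x om) * f x om') xs + G om).
    { unfold G. rewrite <- (Rmult_1_l (lsum (fun x => negpart (f x om) * f x om') xs)).
      rewrite <- (Rmult_1_l (lsum (fun x => negpart (f x om) ^ 2) xs)), <- lsum_lin.
      apply lsum_ext. intros x _. unfold negpart, Rmax.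
      destruct (Rle_dec 0 (- f x om)); ring. }
    assert (H3 : lsum (fun x => (f x om' - f x om) ^ 2) xs <= S).
    { unfold S. apply Rle_trans with (lsum (fun x => (2 * D x) ^ 2) xs); [|lra].
      apply lsum_le. intros x Hx.
      pose proof (proj1 (Rabs_le_between _ _) (HD x om Hx Hom)) as B1.
      pose proof (proj1 (Rabs_le_between _ _) (HD x om' Hx Hom')) as B2.
      nra. }
    assert (Htt : t * eta - t ^ 2 * S = c) by (unfold t, c; field; lra).
    assert (t ^ 2 * lsum (fun x => (f x om' - f x om) ^ 2) xs <= t ^ 2 * S)
      by (apply Rmult_le_compat_l; [apply pow2_ge_0|exact H3]).
    assert (t * eta <= 2 * t * lsum (fun x => negpart (f x om) * (f x om' - f x om)) xs).
    { rewrite H2. nra. }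
    lra. }
  (* Each step lowers the nonnegative penalty by at least c, so it reaches eta after finitely
     many. *)
  assert (Hit : forall N : nat, (exists om, P om /\ G om <= eta)
                          \/ exists om, P om /\ G om <= G om0 - INR N * c).
  { induction N as [|N [IH|(om & Hom & IH)]].
    - right. exists om0. split; [exact H0|]. simpl. lra.
    - left. exact IH.
    - destruct (Rle_dec (G om) eta) as [Hle|Hgt]; [left; exists om; auto|].
      destruct (Hstep om Hom ltac:(lra)) as (om' & Hom' & Hle).
      right. exists om'. split; [exact Hom'|]. rewrite S_INR. lra. }
  assert (Hex : exists om, P om /\ G om <= eta).
  { destruct (INR_unbounded (G om0 / c)) as [N HN].
    destruct (Hit N) as [H|(om & Hom & Hle)]; [exact H|]. exfalso.
    apply Rmult_lt_compat_r with (r := c) in HN; [|exact Hc].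
    replace (G om0 / c * c) with (G om0) in HN by (field; lra).
    specialize (HG om). lra. }
  destruct Hex as (om & Hom & HGe). exists om. split; [exact Hom|]. intros x Hx.
  assert (Hterm : negpart (f x om) ^ 2 <= eta).
  { apply Rle_trans with (2 := HGe). unfold G. clear - Hx.
    induction xs as [|y xs IH]; [destruct Hx|].
    pose proof (lsum_pos (fun x => negpart (f x om) ^ 2) xs (fun x _ => pow2_ge_0 _)).
    rewrite ?lsum_cons; cbv beta. destruct Hx as [->|Hx]; [lra|]. specialize (IH Hx).
    pose proof (pow2_ge_0 (negpart (f y om))). lra. }
  unfold eta in Hterm. pose proof (Rmax_l 0 (- f x om)) as Hn0.
  pose proof (Rmax_r 0 (- f x om)) as Hn1. fold (negpart (f x om)) in Hn0, Hn1.
  apply Rnot_lt_le. intros Hlt. nra.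
Qed.

(** * Ultrafilters and limits of bounded functions *)

(** A transfer of the MathComp ultrafilter lemma. Properness has to be translated: there the empty
    set is excluded, here every member is inhabited. *)
Lemma ultrafilter_exists {T : Type} (F : (T -> Prop) -> Prop) : ProperFilter F ->
  exists U : (T -> Prop) -> Prop, ProperFilter U /\ (forall A, F A -> U A) /\
    forall A, U A \/ U (fun t => ~ A t).
Proof.
  intros HF.
  assert (HF' : @filter.ProperFilter T F).
  { constructor.
    - intros H. destruct (filter_ex _ H) as [t []].
    - constructor.
      + apply filter_true.
      + intros A B HA HB. exact (filter_and A B HA HB).
      + intros A B HAB. exact (filter_imp A B HAB). }
  destruct (filter.ultraFilterLemma HF') as (U & HU & HFU).
  exists U. split; [|split].
  - pose proof (@filter.ultra_proper T U HU) as HP. destruct HP as [Hne [H1 H2 H3]].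
    constructor.
    + intros A HA. apply NNPP. intros Hno. apply Hne. apply (H3 A); [|exact HA].
      intros t Ht. apply Hno. exists t. exact Ht.
    + constructor.
      * exact H1.
      * exact H2.
      * exact H3.
  - exact HFU.
  - intros A. exact (@filter.in_ultra_setVsetC T U A HU).
Qed.

Section Ultralimit.
Context {T : Type} (U : (T -> Prop) -> Prop) {HU : ProperFilter U}.
Hypothesis Hultra : forall A, U A \/ U (fun t => ~ A t).

(** For bounded f this supremum is the limit along U: the lower estimate comes from its definition,
    the upper one from U deciding every set. *)
Definition ulim (f : T -> R) : R := real (Lub_Rbar (fun r => U (fun t => r <= f t))).

Lemma ulim_spec (f : T -> R) (c : R) : (forall t, Rabs (f t) <= c) ->
  forall eps, 0 < eps -> U (fun t => Rabs (f t - ulim f) < eps).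
Proof.
  intros Hf eps Heps.
  set (E := fun r => U (fun t => r <= f t)).
  assert (Hb : forall t, - c <= f t <= c) by (intros t; apply Rabs_le_between, Hf).
  assert (Hlow : Rbar_le (Finite (- c)) (Lub_Rbar E)).
  { apply (proj1 (Lub_Rbar_correct E)). unfold E.
    apply filter_imp with (2 := filter_true). intros t _. apply Hb. }
  assert (Hup : Rbar_le (Lub_Rbar E) (Finite c)).
  { apply (proj2 (Lub_Rbar_correct E)). intros r Hr.
    destruct (filter_ex _ Hr) as [t Ht]. simpl. specialize (Hb t). lra. }
  assert (Hfin : Lub_Rbar E = Finite (ulim f)).
  { unfold ulim. fold E. destruct (Lub_Rbar E); simpl in *; tauto. }
  pose proof (Lub_Rbar_correct E) as [L1 L2]. rewrite Hfin in L1, L2.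
  assert (H1 : U (fun t => ulim f - eps < f t)).
  { assert (Hex : exists r, E r /\ ulim f - eps < r).
    { apply NNPP. intros Hno.
      assert (Hle : Rbar_le (Finite (ulim f)) (Finite (ulim f - eps))).
      { apply L2. intros r Hr. simpl. apply Rnot_lt_le. intros Hlt. apply Hno. exists r. auto. }
      simpl in Hle. lra. }
    destruct Hex as (r & Hr & Hlt). apply filter_imp with (2 := Hr). intros t Ht. lra. }
  assert (H2 : U (fun t => f t < ulim f + eps)).
  { destruct (Hultra (fun t => ulim f + eps <= f t)) as [Hr|Hr].
    - exfalso. assert (Hle : Rbar_le (Finite (ulim f + eps)) (Finite (ulim f))) by (apply L1; exact Hr).
      simpl in Hle. lra.
    - apply filter_imp with (2 := Hr). intros t Ht. lra. }
  apply filter_imp with (2 := filter_and _ _ H1 H2). intros t [Ht1 Ht2].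
  apply Rabs_def1; lra.
Qed.

Definition uclim (f : T -> C) : C := (ulim (fun t => Re (f t)), ulim (fun t => Im (f t))).

Lemma uclim_spec (f : T -> C) (c : R) : (forall t, Cmod (f t) <= c) ->
  forall eps, 0 < eps -> U (fun t => Cmod (uclim f - f t)%C < eps).
Proof.
  intros Hf eps Heps.
  assert (H1 : U (fun t => Rabs (Re (f t) - ulim (fun t => Re (f t))) < eps / 2)).
  { apply ulim_spec with c; [|lra]. intros t. apply Rle_trans with (1 := re_le_Cmod _), Hf. }
  assert (H2 : U (fun t => Rabs (Im (f t) - ulim (fun t => Im (f t))) < eps / 2)).
  { apply ulim_spec with c; [|lra]. intros t. apply Rle_trans with (1 := Rabs_Im_le _), Hf. }
  apply filter_imp with (2 := filter_and _ _ H1 H2). intros t [Ht1 Ht2].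
  assert (Hz : forall z : C, Cmod z <= Rabs (Re z) + Rabs (Im z)).
  { intros z. rewrite <- (sqrt_pow2 (Rabs (Re z) + Rabs (Im z)))
      by (apply Rplus_le_le_0_compat; apply Rabs_pos).
    apply sqrt_le_1_alt. fold (Re z) (Im z).
    pose proof (Rabs_pos (Re z)). pose proof (Rabs_pos (Im z)).
    rewrite <- (pow2_abs (Re z)), <- (pow2_abs (Im z)). nra. }
  apply Rle_lt_trans with (1 := Hz _).
  replace (Re (uclim f - f t)%C) with (- (Re (f t) - ulim (fun t => Re (f t))))
    by (unfold uclim, Re, Im; simpl; ring).
  replace (Im (uclim f - f t)%C) with (- (Im (f t) - ulim (fun t => Im (f t))))
    by (unfold uclim, Re, Im; simpl; ring).
  rewrite !Rabs_Ropp. lra.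
Qed.

End Ultralimit.

(** * States *)

Definition convw (p : nat) (l : list (R * cseq)) : Prop :=
  (forall q, In q l -> 0 <= fst q /\ ball_s' p (snd q)) /\
  fold_right (fun q acc => fst q + acc) 0 l = 1.

Lemma in_s'_ball p xi : (1 <= p)%nat -> ball_s' p xi -> in_s' xi.
Proof. intros Hp H. apply ball_in_s' with p; [exact Hp|]. apply ball_s'_bnd, H. Qed.

Section Convex.
Variable p : nat.
Hypothesis Hp : (1 <= p)%nat.
Implicit Types (l : list (R * cseq)) (x y : op).

Lemma convcomb_bound l x : convw p l -> in_S x -> Cmod (convcomb l x) <= nrm p x.
Proof.
  intros [Hl Hsum] Hx. rewrite <- (Rmult_1_l (nrm p x)), <- Hsum. clear Hsum.
  induction l as [|[a xi] l IH]; simpl.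
  - rewrite Cmod_0. lra.
  - destruct (Hl (a, xi) (or_introl eq_refl)) as [Ha Hb]. simpl in Ha, Hb.
    apply Rle_trans with (1 := Cmod_triangle _ _).
    rewrite Cmod_mult, Cmod_R, Rabs_pos_eq by exact Ha.
    pose proof (phi_vec_bound p xi x Hp (proj1 (ball_s'_bnd p xi) Hb) Hx) as H1.
    specialize (IH (fun q Hq => Hl q (or_intror Hq))).
    pose proof (Rmult_le_compat_l _ _ _ Ha H1). lra.
Qed.

Lemma convcomb_lin l (a : C) x y : convw p l -> in_S x -> in_S y ->
  convcomb l (opadd (opscal a x) y) = (a * convcomb l x + convcomb l y)%C.
Proof.
  intros [Hl _] Hx Hy. induction l as [|[b xi] l IH]; simpl.
  - ring.
  - destruct (Hl (b, xi) (or_introl eq_refl)) as [Hb Hxi]. simpl in Hb, Hxi.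
    rewrite phi_vec_lin by eauto using in_s'_ball.
    rewrite IH by (intros q Hq; apply Hl; right; exact Hq). ring.
Qed.

Lemma convcomb_star_mul l x : convw p l -> in_S x ->
  convcomb l (opmul (star x) x) = RtoC (lsum (fun q => fst q * qf x (snd q)) l).
Proof.
  intros [Hl _] Hx. induction l as [|[b xi] l IH]; simpl; [reflexivity|].
  destruct (Hl (b, xi) (or_introl eq_refl)) as [Hb Hxi]. simpl in Hb, Hxi.
  rewrite phi_vec_star_mul by eauto using in_s'_ball.
  rewrite IH by (intros q Hq; apply Hl; right; exact Hq).
  rewrite <- RtoC_mult, <- RtoC_plus. reflexivity.
Qed.

Lemma convcomb_mul_star l x : convw p l -> in_S x ->
  convcomb l (opmul x (star x)) = RtoC (lsum (fun q => fst q * qf (star x) (snd q)) l).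
Proof.
  intros [Hl _] Hx. induction l as [|[b xi] l IH]; simpl; [reflexivity|].
  destruct (Hl (b, xi) (or_introl eq_refl)) as [Hb Hxi]. simpl in Hb, Hxi.
  rewrite phi_vec_mul_star by eauto using in_s'_ball.
  rewrite IH by (intros q Hq; apply Hl; right; exact Hq).
  rewrite <- RtoC_mult, <- RtoC_plus. reflexivity.
Qed.

Definition rescale (t : R) l : list (R * cseq) := map (fun q => (t * fst q, snd q)) l.

Lemma fold_right_lsum l : fold_right (fun q acc => fst q + acc) 0 l = lsum fst l.
Proof. reflexivity. Qed.

Lemma lsum_rescale t (h : cseq -> R) l :
  lsum (fun q => fst q * h (snd q)) (rescale t l) = t * lsum (fun q => fst q * h (snd q)) l.
Proof.
  unfold rescale. rewrite lsum_map. simpl.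
  induction l as [|q l IH]; simpl; [ring|]. rewrite IH. ring.
Qed.

Lemma convw_mix l l' t : convw p l -> convw p l' -> 0 <= t <= 1 ->
  convw p (rescale (1 - t) l ++ rescale t l').
Proof.
  intros [Hl Hs] [Hl' Hs'] Ht. split.
  - intros q Hq. apply in_app_iff in Hq.
    destruct Hq as [Hq|Hq]; apply in_map_iff in Hq; destruct Hq as (q' & <- & Hq'); simpl.
    + destruct (Hl q' Hq'). split; [apply Rmult_le_pos; lra|assumption].
    + destruct (Hl' q' Hq'). split; [apply Rmult_le_pos; lra|assumption].
  - rewrite fold_right_lsum in *. rewrite lsum_app.
    unfold rescale. rewrite !lsum_map. simpl.
    assert (E : forall s (m : list (R * cseq)), lsum (fun q => s * fst q) m = s * lsum fst m).
    { intros s m. induction m as [|q m IH]; simpl; [ring|]. rewrite IH. ring. }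
    rewrite !E, Hs, Hs'. ring.
Qed.

(** Weak-star compactness in the form used here. The bound ||x||_p on convex combinations makes the
    scalar limits exist and the limit functional continuous, and any finite list of tests is met by
    a single t, which places the limit in the closed convex hull. *)
Lemma ultralimit_state {T : Type} (U : (T -> Prop) -> Prop) (om : T -> list (R * cseq)) :
  ProperFilter U -> (forall A, U A \/ U (fun t => ~ A t)) -> (forall t, convw p (om t)) ->
  exists phi, is_state p phi /\
    forall x eps, in_S x -> 0 < eps -> U (fun t => Cmod (phi x - convcomb (om t) x)%C < eps).
Proof.
  intros HU Hultra Hom.
  exists (fun x => uclim U (fun t => convcomb (om t) x)).
  assert (Happ : forall x eps, in_S x -> 0 < eps ->
    U (fun t => Cmod (uclim U (fun t => convcomb (om t) x) - convcomb (om t) x)%C < eps)).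
  { intros x eps Hx Heps. apply (uclim_spec U Hultra (fun t => convcomb (om t) x) (nrm p x)); [|exact Heps].
    intros t. apply convcomb_bound; auto. }
  split; [|exact Happ]. split; [|split].
  - intros a x y Hx Hy.
    set (phi := fun x => uclim U (fun t => convcomb (om t) x)) in *.
    change (phi (opadd (opscal a x) y) = (a * phi x + phi y)%C).
    apply Ceq_minus. apply Cmod_eq_0. apply Rle_antisym; [|apply Cmod_ge_0].
    apply le_epsilon. intros eps Heps. pose proof (Cmod_ge_0 a) as Ha.
    (* Three errors add up: d at the combination, |a| d at x, and d at y. *)
    set (d := eps / (Cmod a + 2)). assert (Hd : 0 < d) by (apply Rdiv_lt_0_compat; lra).
    assert (Ed : d * (Cmod a + 2) = eps) by (unfold d; field; lra).
    pose proof (Happ _ d (in_S_lincomb a x y Hx Hy) Hd) as H1.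
    pose proof (Happ _ d Hx Hd) as H2. pose proof (Happ _ d Hy Hd) as H3.
    destruct (filter_ex _ (filter_and _ _ H1 (filter_and _ _ H2 H3))) as (t & Ht1 & Ht2 & Ht3).
    change (Cmod (phi (opadd (opscal a x) y) - convcomb (om t) (opadd (opscal a x) y))%C < d) in Ht1.
    change (Cmod (phi x - convcomb (om t) x)%C < d) in Ht2.
    change (Cmod (phi y - convcomb (om t) y)%C < d) in Ht3.
    rewrite convcomb_lin in Ht1 by auto.
    set (A := phi (opadd (opscal a x) y)) in *.
    replace (A - (a * phi x + phi y))%C with
      ((A - (a * convcomb (om t) x + convcomb (om t) y))
       + (- (a * (phi x - convcomb (om t) x)) + - (phi y - convcomb (om t) y)))%C by ring.
    apply Rle_trans with (1 := Cmod_triangle _ _).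
    pose proof (Cmod_triangle (- (a * (phi x - convcomb (om t) x))) (- (phi y - convcomb (om t) y))) as Htr.
    rewrite !Cmod_opp, Cmod_mult in Htr. nra.
  - exists p, 1. split; [exact Hp|]. intros x Hx. rewrite (opnorm_nrm p x Hx Hp). simpl.
    rewrite Rmult_1_l. apply le_epsilon. intros eps Heps.
    destruct (filter_ex _ (Happ x eps Hx Heps)) as [t Ht].
    replace (uclim U (fun t => convcomb (om t) x)) with
      ((uclim U (fun t => convcomb (om t) x) - convcomb (om t) x) + convcomb (om t) x)%C by ring.
    apply Rle_trans with (1 := Cmod_triangle _ _).
    pose proof (convcomb_bound (om t) x (Hom t) Hx). lra.
  - intros xs eps Hxs Heps.
    assert (Hall : U (fun t => forall x, In x xs ->
      Cmod (uclim U (fun t => convcomb (om t) x) - convcomb (om t) x)%C < eps)).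
    { induction xs as [|y xs IH].
      - apply filter_imp with (2 := filter_true). intros t _ x [].
      - apply filter_imp with
          (2 := filter_and _ _ (Happ y eps (Hxs y (or_introl eq_refl)) Heps)
                               (IH (fun x Hx => Hxs x (or_intror Hx)))).
        intros t [H1 H2] x [<-|Hx]; [exact H1|exact (H2 x Hx)]. }
    destruct (filter_ex _ Hall) as [t Ht]. exists (om t).
    destruct (Hom t) as [H1 H2]. auto.
Qed.

(** Both limits are taken along one ultrafilter, so that a lower bound on the sum at a common t
    survives. *)
Lemma limit_states {T : Type} (F : (T -> Prop) -> Prop) (om1 om2 : T -> list (R * cseq)) :
  ProperFilter F -> (forall t, convw p (om1 t)) -> (forall t, convw p (om2 t)) ->
  exists phi1 phi2, is_state p phi1 /\ is_state p phi2 /\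
    forall x y r, in_S x -> in_S y ->
      (forall eps, 0 < eps -> F (fun t => r - eps <= Re (convcomb (om1 t) x + convcomb (om2 t) y)%C)) ->
      r <= Re (phi1 x + phi2 y)%C.
Proof.
  intros HF H1 H2. destruct (ultrafilter_exists F HF) as (U & HU & HFU & Hultra).
  destruct (ultralimit_state U om1 HU Hultra H1) as (phi1 & Hs1 & Ha1).
  destruct (ultralimit_state U om2 HU Hultra H2) as (phi2 & Hs2 & Ha2).
  exists phi1, phi2. split; [exact Hs1|]. split; [exact Hs2|].
  intros x y r Hx Hy Hr. apply le_epsilon. intros eps Heps.
  assert (Hd : 0 < eps / 3) by lra.
  destruct (filter_ex _ (filter_and _ _ (HFU _ (Hr _ Hd)) (filter_and _ _ (Ha1 x _ Hx Hd) (Ha2 y _ Hy Hd))))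
    as (t & Ht0 & Ht1 & Ht2).
  pose proof (Rle_trans _ _ _ (re_le_Cmod _) (Rlt_le _ _ Ht1)) as B1.
  pose proof (Rle_trans _ _ _ (re_le_Cmod _) (Rlt_le _ _ Ht2)) as B2.
  apply Rabs_le_between in B1. apply Rabs_le_between in B2.
  unfold Re in *. simpl in *. lra.
Qed.

End Convex.

(** * A faithful state *)

Definition scaled_basis (p i : nat) : cseq := fun j => (sqrt (wt p i) * basis i j)%C.

Lemma scaled_basis_ball p i : ball_s' p (scaled_basis p i).
Proof.
  apply ball_s'_bnd. apply bnd_le with (Cmod (sqrt (wt p i)) ^ 2 * wt' p i).
  - rewrite Cmod_R, Rabs_pos_eq by apply sqrt_pos. rewrite pow2_sqrt by (left; apply wt_pos).
    unfold wt'. right. field. pose proof (wt_pos p i). lra.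
  - apply (bnd_scal _ (basis i)), bnd_basis, wt'_pos.
Qed.

(* The zero vector carries the weight not yet distributed. *)
Definition faithful_approx (p N : nat) : list (R * cseq) :=
  (((1 / 2) ^ N, fun _ => RtoC 0) : R * cseq)
    :: map (fun i => ((1 / 2) ^ S i, scaled_basis p i)) (seq 0 N).

Lemma faithful_approx_convw p N : convw p (faithful_approx p N).
Proof.
  split.
  - intros q [<-|Hq]; simpl.
    + split; [apply pow_le; lra|]. apply ball_s'_bnd, bnd_zero. lra.
    + apply in_map_iff in Hq. destruct Hq as (i & <- & _). cbn [fst snd].
      split; [apply pow_le; lra|apply scaled_basis_ball].
  - unfold faithful_approx. rewrite fold_right_lsum. rewrite ?lsum_cons; cbv beta. rewrite lsum_map. simpl fst.
    induction N as [|N IH]; [simpl; ring|].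
    rewrite seq_S, lsum_app. rewrite ?lsum_cons; cbv beta. simpl in IH |- *. lra.
Qed.

(** Each scaled coordinate vector keeps a fixed positive weight along [faithful_approx], and all
    other terms are nonnegative, so a nonpositive value makes x vanish on every coordinate
    vector. *)
Lemma faithful_states p : (1 <= p)%nat -> exists phi1 phi2, is_state p phi1 /\ is_state p phi2 /\
  forall x, in_S x -> Re (phi1 (opmul (star x) x) + phi2 (opmul x (star x)))%C <= 0 ->
    op_eq x opzero.
Proof.
  intros Hp.
  destruct (limit_states p Hp eventually (faithful_approx p) (faithful_approx p))
    as (phi1 & phi2 & H1 & H2 & Hlim); auto using faithful_approx_convw, eventually_filter.
  exists phi1, phi2. split; [exact H1|]. split; [exact H2|]. intros x Hx Hle.
  assert (Hq : forall i, qf x (scaled_basis p i) <= 0).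
  { intros i. set (r := (1 / 2) ^ S i * qf x (scaled_basis p i)).
    assert (Hr : r <= Re (phi1 (opmul (star x) x) + phi2 (opmul x (star x)))%C).
    (* The i-th vector is in the list as soon as N > i, with a weight that no longer depends on
       N. *)
    { apply Hlim; auto using in_S_opmul, star_in_S. intros eps Heps. exists (S i). intros N HN.
      rewrite convcomb_star_mul with (p := p), convcomb_mul_star with (p := p)
        by auto using faithful_approx_convw.
      assert (Hpos : forall y, in_S y -> forall q, In q (faithful_approx p N) ->
                0 <= fst q * qf y (snd q)).
      { intros y Hy q Hq. destruct (proj1 (faithful_approx_convw p N) q Hq) as [Ha Hb].
        apply Rmult_le_pos; [exact Ha|]. apply qf_pos; eauto using in_s'_ball. }
      pose proof (lsum_pos _ _ (Hpos (star x) (star_in_S x Hx))) as Hs2.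
      assert (Hs1 : r <= lsum (fun q => fst q * qf x (snd q)) (faithful_approx p N)).
      { assert (Hin : In ((1 / 2) ^ S i, scaled_basis p i) (faithful_approx p N)).
        { right. apply in_map_iff. exists i. split; [reflexivity|]. apply in_seq. lia. }
        specialize (Hpos x Hx). clear - Hin Hpos.
        induction (faithful_approx p N) as [|q l IH]; [destruct Hin|]. rewrite ?lsum_cons; cbv beta.
        assert (Hl : forall q, In q l -> 0 <= fst q * qf x (snd q))
          by (intros q' Hq'; apply Hpos; right; exact Hq').
        destruct Hin as [->|Hin].
        - pose proof (lsum_pos _ _ Hl). unfold r. cbn [fst snd]. lra.
        - specialize (IH Hl Hin). specialize (Hpos q (or_introl eq_refl)). lra. }
      rewrite <- RtoC_plus.
      change (r - eps <= lsum (fun q => fst q * qf x (snd q)) (faithful_approx p N)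
         + lsum (fun q => fst q * qf (star x) (snd q)) (faithful_approx p N)). lra. }
    assert (0 < (1 / 2) ^ S i) by (apply pow_lt; lra). unfold r in Hr.
    apply Rnot_lt_le. intros Hlt. assert (0 < (1 / 2) ^ S i * qf x (scaled_basis p i))
      by (apply Rmult_lt_0_compat; assumption). lra. }
  assert (Hb : forall i, x (basis i) = fun _ => RtoC 0).
  { intros i. pose proof (in_s'_ball p _ Hp (scaled_basis_ball p i)) as Hin.
    assert (Hz : qf x (scaled_basis p i) = 0)
      by (apply Rle_antisym; [apply Hq|apply qf_pos; assumption]).
    pose proof (pairing_self_zero _ (in_S_apply x _ Hx Hin) Hz) as H0.
    apply functional_extensionality. intros j. specialize (H0 j).
    unfold scaled_basis in H0. rewrite (in_S_scal_vec x _ _ Hx (basis_in_s' i)) in H0.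
    assert (Hne : RtoC (sqrt (wt p i)) <> 0%C).
    { intros E. injection E as E. pose proof (sqrt_lt_R0 _ (wt_pos p i)). lra. }
    apply NNPP. intros Hno. exact (Cmult_neq_0 _ _ Hne Hno H0). }
  intros xi Hxi.
  (* The adjoint replaces a density argument: the coordinates of x* eta are pairings with the x e_i,
     so x* = 0, and then x = x** = 0 on all of s'. *)
  assert (Hs : op_eq (star x) opzero).
  { intros eta Heta. rewrite (star_adj x Hx eta Heta). apply functional_extensionality.
    intros i. unfold adj. rewrite Hb. apply pairing_zero_r. }
  rewrite <- (star_star x Hx xi Hxi), (star_adj _ (star_in_S x Hx) xi Hxi).
  apply functional_extensionality. intros i. unfold adj.
  rewrite (Hs _ (basis_in_s' i)). apply pairing_zero_r.
Qed.

Lemma Kconst_pos : Rbar_le (Finite 0) Kconst.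
Proof.
  apply (proj1 (Lub_Rbar_correct _)). exists 1%nat. split; [lia|].
  apply (proj2 (Glb_Rbar_correct _)). intros c (Hc & _). exact Hc.
Qed.

Lemma qf_bounded p x : (1 <= p)%nat -> in_S x -> exists T, 0 <= T /\
  (forall xi, bnd (wt' p) xi 1 -> qf x xi <= T) /\
  (forall xi, bnd (wt' p) xi 1 -> qf (star x) xi <= T).
Proof.
  intros Hp Hx. exists (nrm p (opmul (star x) x) + nrm p (opmul (star (star x)) (star x))).
  pose proof (nrm_pos p (opmul (star x) x)). pose proof (nrm_pos p (opmul (star (star x)) (star x))).
  split; [lra|]. split; intros xi Hxi.
  - pose proof (qf_bound p x xi Hp Hx Hxi). lra.
  - pose proof (qf_bound p (star x) xi Hp (star_in_S x Hx) Hxi). lra.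
Qed.

Lemma convw_singleton q xi : bnd (wt' q) xi 1 -> convw q ((1, xi) :: nil).
Proof.
  intros Hxi. split; [|simpl; ring]. intros r [<-|[]]. simpl.
  split; [lra|]. apply ball_s'_bnd, Hxi.
Qed.

(** * Domination by states for finite constants *)

Section Main.
Variable H : FrechetHilbert.
Variable u : op -> H.
Hypothesis Hlin : lin_map H u.
Hypothesis Hcont : cont_map H u.
Variables n k : nat.
Hypothesis Hn : (1 <= n)%nat.
Notation p := (2 * n + 1)%nat.

(** With c = K ||u||_{n,k}^2, nonnegativity at x is the squared form of the goal for convex
    combinations of vector states. The expression respects mixtures of om, as the minimax principle
    demands. *)
Definition slack (c : R) (x : op) (om : list (R * cseq) * list (R * cseq)) : R :=
  c * (lsum (fun q => fst q * qf x (snd q)) (fst om)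
       + lsum (fun q => fst q * qf (star x) (snd q)) (snd om))
  - FH_norm H k (u x) ^ 2.

Lemma slack_singleton c x xi eta :
  slack c x ((1, xi) :: nil, (1, eta) :: nil)
  = c * (qf x xi + qf (star x) eta) - FH_norm H k (u x) ^ 2.
Proof. unfold slack. simpl. ring. Qed.

Lemma convw_lsum_bound l (h : cseq -> R) T : convw p l ->
  (forall xi, bnd (wt' p) xi 1 -> 0 <= h xi <= T) ->
  0 <= lsum (fun q => fst q * h (snd q)) l <= T.
Proof.
  intros [Hl Hs] Hh. split.
  - apply lsum_pos. intros q Hq. destruct (Hl q Hq) as [Ha Hb].
    apply Rmult_le_pos; [exact Ha|]. apply Hh, ball_s'_bnd, Hb.
  - rewrite <- (Rmult_1_l T), <- Hs. clear Hs. induction l as [|q l IH]; simpl; [lra|].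
    destruct (Hl q (or_introl eq_refl)) as [Ha Hb].
    specialize (IH (fun r Hr => Hl r (or_intror Hr))).
    apply ball_s'_bnd in Hb. destruct (Hh _ Hb) as [_ HT].
    pose proof (Rmult_le_compat_l _ _ _ Ha HT). lra.
Qed.

Lemma slack_dual K M xs (lam : op -> R) delta :
  Kconst = Finite K -> mapnorm H n k u = Finite M ->
  (forall x, In x xs -> in_S x) -> (forall x, 0 <= lam x) -> 0 < delta ->
  exists xi eta, bnd (wt' p) xi 1 /\ bnd (wt' p) eta 1 /\
    - delta <= lsum (fun x => lam x * slack (K * M ^ 2) x ((1, xi) :: nil, (1, eta) :: nil)) xs.
Proof.
  intros HK HM Hxs Hlam Hdelta. set (c := K * M ^ 2).
  assert (Hc : 0 <= c).
  { pose proof Kconst_pos as HK0. rewrite HK in HK0. apply Rmult_le_pos; [exact HK0|apply pow2_ge_0]. }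
  set (A := fun xi => lsum (fun x => lam x * qf x xi) xs).
  set (B := fun xi => lsum (fun x => lam x * qf (star x) xi) xs).
  set (L := lsum (fun x => lam x * FH_norm H k (u x) ^ 2) xs).
  assert (E : forall xi eta,
    lsum (fun x => lam x * slack c x ((1, xi) :: nil, (1, eta) :: nil)) xs = c * (A xi + B eta) - L).
  { intros xi eta.
    transitivity (lsum (fun x => c * (1 * (lam x * qf x xi) + 1 * (lam x * qf (star x) eta))
                       + (-1) * (lam x * FH_norm H k (u x) ^ 2)) xs).
    - apply lsum_ext. intros x _. rewrite slack_singleton. ring.
    - rewrite !lsum_lin. unfold A, B, L. ring. }
  (* [qf] and the squared seminorm are quadratic, so square roots of the weights can be absorbed
     into the operators. *)
  set (ys := map (fun x => opscal (RtoC (sqrt (lam x))) x) xs).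
  assert (Hys : forall y, In y ys -> in_S y).
  { intros y Hy. apply in_map_iff in Hy. destruct Hy as (x & <- & Hx). auto using in_S_opscal. }
  assert (Hsq : forall x, Cmod (RtoC (sqrt (lam x))) ^ 2 = lam x).
  { intros x. rewrite Cmod_R, Rabs_pos_eq by apply sqrt_pos. apply pow2_sqrt, Hlam. }
  assert (EA : forall xi, bnd (wt' p) xi 1 -> lsum (fun y => qf y xi) ys = A xi).
  { intros xi Hxi. unfold ys. rewrite lsum_map. apply lsum_ext. intros x Hx.
    rewrite qf_opscal, Hsq; auto. apply ball_in_s' with p; [lia|exact Hxi]. }
  assert (EB : forall xi, bnd (wt' p) xi 1 -> lsum (fun y => qf (star y) xi) ys = B xi).
  { intros xi Hxi. unfold ys. rewrite lsum_map. apply lsum_ext. intros x Hx.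
    rewrite qf_star_opscal, Hsq; auto. apply ball_in_s' with p; [lia|exact Hxi]. }
  assert (EL : lsum (fun y => FH_norm H k (u y) ^ 2) ys = L).
  { unfold ys. rewrite lsum_map. apply lsum_ext. intros x Hx.
    rewrite (u_opscal H u Hlin), FH_norm_scal, Rpow_mult_distr, Hsq; auto. }
  assert (Hpos : forall xi, bnd (wt' p) xi 1 -> 0 <= A xi /\ 0 <= B xi).
  { intros xi Hxi. assert (Hin : in_s' xi) by (apply ball_in_s' with p; [lia|exact Hxi]).
    split; apply lsum_pos; intros x Hx; apply Rmult_le_pos; auto using qf_pos, star_in_S. }
  assert (Hmain : forall T, 0 <= T -> (forall xi, bnd (wt' p) xi 1 -> A xi <= T) ->
     (forall xi, bnd (wt' p) xi 1 -> B xi <= T) -> L <= c * T).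
  { intros T HT HA HB. rewrite <- EL. apply (sum_u_le H u Hlin Hcont n k Hn K M); auto.
    - intros xi Hxi. rewrite EA; auto.
    - intros xi Hxi. rewrite EB; auto. }
  apply NNPP. intros Hno.
  (* If every pair fails and c > 0, pairing each vector with the zero vector bounds A and B
     separately by (L - delta) / c. This is where the maximum in ||.||^rc meets the sum of two
     states; the inequality of K then yields L <= L - delta. *)
  assert (Hlt : forall xi eta, bnd (wt' p) xi 1 -> bnd (wt' p) eta 1 -> c * (A xi + B eta) < L - delta).
  { intros xi eta Hxi Heta. apply Rnot_le_lt. intros Hle. apply Hno. exists xi, eta.
    split; [exact Hxi|]. split; [exact Heta|]. rewrite E. lra. }
  assert (H0 : bnd (wt' p) (fun _ => RtoC 0) 1) by (apply bnd_zero; lra).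
  assert (HR : 0 < L - delta).
  { apply Rle_lt_trans with (2 := Hlt _ _ H0 H0). destruct (Hpos _ H0).
    apply Rmult_le_pos; lra. }
  (* For c = 0 there is nothing to divide by, but any common finite bound T gives L <= 0, against L
     > delta. *)
  destruct (Req_dec c 0) as [Hc0|Hc0].
  - assert (HT : exists T, 0 <= T /\ (forall xi, bnd (wt' p) xi 1 -> A xi <= T) /\
       (forall xi, bnd (wt' p) xi 1 -> B xi <= T)).
    { unfold A, B. clear - Hxs Hlam. induction xs as [|x l IH].
      - exists 0. simpl. split; [lra|]. split; intros; lra.
      - destruct IH as (T & HT & HT1 & HT2); [intros y Hy; apply Hxs; right; exact Hy|].
        destruct (qf_bounded p x ltac:(lia) (Hxs x (or_introl eq_refl))) as (T' & HT' & HT1' & HT2').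
        specialize (Hlam x). exists (lam x * T' + T). split; [nra|].
        split; intros xi Hxi; rewrite ?lsum_cons; cbv beta.
        + specialize (HT1 xi Hxi). specialize (HT1' xi Hxi). nra.
        + specialize (HT2 xi Hxi). specialize (HT2' xi Hxi). nra. }
    destruct HT as (T & HT & HA & HB). specialize (Hmain T HT HA HB). rewrite Hc0 in Hmain. lra.
  - assert (Hcp : 0 < c) by lra.
    assert (Hdiv : forall a, c * a < L - delta -> a <= (L - delta) / c).
    { intros a Ha. apply Rmult_le_reg_l with c; [exact Hcp|].
      replace (c * ((L - delta) / c)) with (L - delta) by (field; exact Hc0). lra. }
    assert (HL : L <= c * ((L - delta) / c)).
    { apply Hmain.
      - left. apply Rdiv_lt_0_compat; assumption.
      - intros xi Hxi. apply Hdiv. apply Rle_lt_trans with (2 := Hlt xi _ Hxi H0).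
        apply Rmult_le_compat_l; [exact Hc|]. destruct (Hpos _ H0). lra.
      - intros xi Hxi. apply Hdiv. apply Rle_lt_trans with (2 := Hlt _ xi H0 Hxi).
        apply Rmult_le_compat_l; [exact Hc|]. destruct (Hpos _ H0). lra. }
    replace (c * ((L - delta) / c)) with (L - delta) in HL by (field; exact Hc0). lra.
Qed.

Lemma finite_domination K M xs eps :
  Kconst = Finite K -> mapnorm H n k u = Finite M ->
  (forall x, In x xs -> in_S x) -> 0 < eps ->
  exists om, (convw p (fst om) /\ convw p (snd om)) /\
    forall x, In x xs -> - eps <= slack (K * M ^ 2) x om.
Proof.
  intros HK HM Hxs Heps. set (c := K * M ^ 2).
  assert (Hc : 0 <= c).
  { pose proof Kconst_pos as HK0. rewrite HK in HK0. apply Rmult_le_pos; [exact HK0|apply pow2_ge_0]. }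
  assert (HT : exists T : op -> R, forall x, in_S x -> 0 <= T x /\
    (forall xi, bnd (wt' p) xi 1 -> qf x xi <= T x) /\
    (forall xi, bnd (wt' p) xi 1 -> qf (star x) xi <= T x)).
  { apply (fun_choice (fun x T => in_S x -> 0 <= T /\
      (forall xi, bnd (wt' p) xi 1 -> qf x xi <= T) /\
      (forall xi, bnd (wt' p) xi 1 -> qf (star x) xi <= T))).
    intros x. destruct (classic (in_S x)) as [Hx|Hx].
    - destruct (qf_bounded p x ltac:(lia) Hx) as (T & HT). exists T. auto.
    - exists 0. tauto. }
  destruct HT as (T & HT).
  apply (finite_minimax (fun om => convw p (fst om) /\ convw p (snd om)) (slack c)
           (fun x => c * (2 * T x) + FH_norm H k (u x) ^ 2)); [| | | |exact Heps].
  - exists ((1, fun _ => RtoC 0) :: nil, (1, fun _ => RtoC 0) :: nil).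
    split; apply convw_singleton, bnd_zero; lra.
  - intros x om Hx [Ho1 Ho2]. destruct (HT x (Hxs x Hx)) as (HT0 & HT1 & HT2).
    assert (Hq : forall y xi, in_S y -> bnd (wt' p) xi 1 -> 0 <= qf y xi).
    { intros y xi Hy Hxi. apply qf_pos; [exact Hy|]. apply ball_in_s' with p; [lia|exact Hxi]. }
    destruct (convw_lsum_bound (fst om) (qf x) (T x) Ho1) as [B1 B2]; [auto|].
    destruct (convw_lsum_bound (snd om) (qf (star x)) (T x) Ho2) as [B3 B4]; [auto using star_in_S|].
    unfold slack. pose proof (pow2_ge_0 (FH_norm H k (u x))). apply Rabs_le.
    set (a := lsum _ (fst om)) in *. set (b := lsum _ (snd om)) in *.
    assert (0 <= c * (a + b)) by (apply Rmult_le_pos; lra).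
    assert (c * (a + b) <= c * (2 * T x)) by (apply Rmult_le_compat_l; lra).
    lra.
  - intros om om' t [Ho1 Ho2] [Ho1' Ho2'] Ht.
    exists (rescale (1 - t) (fst om) ++ rescale t (fst om'),
            rescale (1 - t) (snd om) ++ rescale t (snd om')). split.
    + split; apply convw_mix; assumption.
    + intros x _. unfold slack. cbn [fst snd]. rewrite !lsum_app, !lsum_rescale. ring.
  - intros lam Hlam delta Hdelta.
    destruct (slack_dual K M xs lam delta HK HM Hxs Hlam Hdelta) as (xi & eta & Hxi & Heta & Hle).
    exists ((1, xi) :: nil, (1, eta) :: nil). split; [|exact Hle].
    split; apply convw_singleton; assumption.
Qed.

Lemma domination K M : Kconst = Finite K -> mapnorm H n k u = Finite M ->
  exists phi1 phi2, is_state p phi1 /\ is_state p phi2 /\ forall x, in_S x ->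
    FH_norm H k (u x) ^ 2
    <= K * M ^ 2 * Re (phi1 (opmul (star x) x) + phi2 (opmul x (star x)))%C.
Proof.
  intros HK HM. set (c := K * M ^ 2).
  assert (Hc : 0 <= c).
  { pose proof Kconst_pos as HK0. rewrite HK in HK0. apply Rmult_le_pos; [exact HK0|apply pow2_ge_0]. }
  (* Invalid lists and tolerances receive a dummy pair, because [limit_states] expects convex
     weights at every index. *)
  destruct (fun_choice (fun (t : list op * R) om => (convw p (fst om) /\ convw p (snd om)) /\
    ((forall x, In x (fst t) -> in_S x) -> 0 < snd t ->
      forall x, In x (fst t) -> - snd t <= slack c x om))) as (om & Hom).
  { intros [xs eps]. cbn [fst snd].
    destruct (classic ((forall x, In x xs -> in_S x) /\ 0 < eps)) as [[Hxs Heps]|Hno].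
    - destruct (finite_domination K M xs eps HK HM Hxs Heps) as (om & Ho & Hs). exists om. auto.
    - exists ((1, fun _ => RtoC 0) :: nil, (1, fun _ => RtoC 0) :: nil). split.
      + split; apply convw_singleton, bnd_zero; lra.
      + intros Hxs Heps. tauto. }
  (* The tail filter for larger lists and smaller tolerances, restricted to valid pairs, where the
     chosen combinations carry information. *)
  set (F := fun A : list op * R -> Prop => exists xs eps, (forall x, In x xs -> in_S x) /\ 0 < eps /\
    forall ys e, incl xs ys -> (forall x, In x ys -> in_S x) -> 0 < e <= eps -> A (ys, e)).
  assert (HF : ProperFilter F).
  { constructor.
    - intros A (xs & eps & Hxs & Heps & HA). exists (xs, eps). apply HA; auto using incl_refl. lra.
    - constructor.
      + exists nil, 1. split; [intros x []|]. split; [lra|]. auto.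
      + intros A B (xs & e1 & Hxs & He1 & HA) (ys & e2 & Hys & He2 & HB).
        exists (xs ++ ys), (Rmin e1 e2). split; [|split].
        * intros x Hx. apply in_app_iff in Hx. destruct Hx; auto.
        * apply Rmin_glb_lt; assumption.
        * intros zs e Hincl Hzs He. pose proof (Rmin_l e1 e2). pose proof (Rmin_r e1 e2). split.
          -- apply HA; [|exact Hzs|lra]. intros x Hx. apply Hincl, in_app_iff. auto.
          -- apply HB; [|exact Hzs|lra]. intros x Hx. apply Hincl, in_app_iff. auto.
      + intros A B HAB (xs & e1 & Hxs & He1 & HA). exists xs, e1. auto. }
  destruct (limit_states p ltac:(lia) F (fun t => fst (om t)) (fun t => snd (om t)) HF)
    as (phi1 & phi2 & Hs1 & Hs2 & Hlim).
  { intros t. apply (proj1 (Hom t)). }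
  { intros t. apply (proj1 (Hom t)). }
  exists phi1, phi2. split; [exact Hs1|]. split; [exact Hs2|]. intros x Hx.
  assert (Heq : forall t, Re (convcomb (fst (om t)) (opmul (star x) x)
                   + convcomb (snd (om t)) (opmul x (star x)))%C
     = lsum (fun q => fst q * qf x (snd q)) (fst (om t))
       + lsum (fun q => fst q * qf (star x) (snd q)) (snd (om t))).
  { intros t. destruct (proj1 (Hom t)) as [H1 H2].
    rewrite (convcomb_star_mul p) by (auto; lia). rewrite (convcomb_mul_star p) by (auto; lia).
    reflexivity. }
  assert (Hslack : forall eps, 0 < eps -> F (fun t => - eps <= slack c x (om t))).
  { intros eps Heps. exists (x :: nil), eps. split; [intros y [<-|[]]; exact Hx|].
    split; [exact Heps|]. intros ys e Hincl Hys He.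
    pose proof (proj2 (Hom (ys, e)) Hys (proj1 He) x (Hincl x (or_introl eq_refl))) as Hs.
    cbn [snd] in Hs. lra. }
  (* For c > 0 the limit is applied with r = ||u x||_k^2 / c; for c = 0 the slack alone bounds ||u
     x||_k^2 by every positive eps. *)
  destruct (Req_dec c 0) as [Hc0|Hc0].
  - rewrite Hc0, Rmult_0_l. apply le_epsilon. intros eps Heps.
    destruct (filter_ex _ (Hslack eps Heps)) as [t Ht]. unfold slack in Ht. rewrite Hc0 in Ht. lra.
  - assert (Hcp : 0 < c) by lra.
    assert (Hr : FH_norm H k (u x) ^ 2 / c
                 <= Re (phi1 (opmul (star x) x) + phi2 (opmul x (star x)))%C).
    { apply Hlim; auto using in_S_opmul, star_in_S. intros eps Heps.
      apply filter_imp with (2 := Hslack (c * eps) ltac:(apply Rmult_lt_0_compat; assumption)).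
      intros t Ht. rewrite Heq. unfold slack in Ht.
      apply Rmult_le_reg_l with c; [exact Hcp|].
      replace (c * (FH_norm H k (u x) ^ 2 / c - eps)) with (FH_norm H k (u x) ^ 2 - c * eps)
        by (field; exact Hc0).
      lra. }
    apply Rmult_le_compat_l with (r := c) in Hr; [|exact Hc].
    replace (c * (FH_norm H k (u x) ^ 2 / c)) with (FH_norm H k (u x) ^ 2) in Hr
      by (field; exact Hc0).
    exact Hr.
Qed.

End Main.

(* If K = 0 then u vanishes: use the inequality at a level m for which ||u||_{m,k} is finite. *)
Lemma Kconst_zero_u (H : FrechetHilbert) (u : op -> H) k :
  lin_map H u -> cont_map H u -> Kconst = Finite 0 ->
  forall x, in_S x -> FH_norm H k (u x) = 0.
Proof.
  intros Hlin Hcont HK x Hx.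
  destruct (cont_map_nrm H u Hcont k) as (m & c & Hm & Hc & Hb).
  assert (HM : exists M, mapnorm H m k u = Finite M).
  { pose proof (mapnorm_pos H u m k Hm) as H0.
    assert (H1 : Rbar_le (mapnorm H m k u) (Finite c)).
    { apply (proj2 (Lub_Rbar_correct _)). intros r (y & Hy & Hny & Hr). simpl.
      rewrite (opnorm_nrm m y Hy Hm) in Hny. simpl in Hny.
      specialize (Hb y Hy). nra. }
    destruct (mapnorm H m k u) as [M| |]; simpl in *; [exists M; reflexivity|tauto|tauto]. }
  destruct HM as (M & HM).
  destruct (domination H u Hlin Hcont m k Hm 0 M HK HM) as (phi1 & phi2 & _ & _ & Hd).
  specialize (Hd x Hx). rewrite !Rmult_0_l in Hd.
  pose proof (FH_norm_pos H k (u x)). nra.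
Qed.

(** * Extended-real products and the theorem *)

Lemma Rbar_mult_pos (a b : Rbar) :
  Rbar_le (Finite 0) a -> Rbar_le (Finite 0) b -> Rbar_le (Finite 0) (Rbar_mult a b).
Proof.
  destruct a as [a| |], b as [b| |]; simpl; try tauto; intros Ha Hb.
  - apply Rmult_le_pos; assumption.
  - unfold Rbar_mult, Rbar_mult'. destruct (Rle_dec 0 a); [|contradiction].
    destruct (Rle_lt_or_eq_dec 0 a r); simpl; lra || exact I.
  - unfold Rbar_mult, Rbar_mult'. destruct (Rle_dec 0 b); [|contradiction].
    destruct (Rle_lt_or_eq_dec 0 b r); simpl; lra || exact I.
Qed.

Lemma Rbar_mult_infty_l (a : Rbar) : Rbar_lt (Finite 0) a -> Rbar_mult p_infty a = p_infty.
Proof.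
  destruct a as [a| |]; intros Ha; [|reflexivity|destruct Ha].
  apply is_Rbar_mult_unique, is_Rbar_mult_p_infty_pos. exact Ha.
Qed.

Lemma Rbar_mult_infty_r (a : Rbar) : Rbar_lt (Finite 0) a -> Rbar_mult a p_infty = p_infty.
Proof. intros Ha. rewrite Rbar_mult_comm. apply Rbar_mult_infty_l, Ha. Qed.

Theorem theorem4p3 (H : FrechetHilbert) (u : op -> H) (k n : nat) :
  lin_map H u -> cont_map H u -> (1 <= n)%nat ->
  exists phi1 phi2 : op -> C,
    is_state (2*n+1) phi1 /\ is_state (2*n+1) phi2 /\
    forall x, in_S x ->
      Rbar_le (Finite (FH_norm H k (u x)))
        (Rbar_mult (Rbar_mult (Rbar_sqrt Kconst) (mapnorm H n k u))
           (Finite (sqrt (Re (phi1 (opmul (star x) x) + phi2 (opmul x (star x)))%C)))).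
Proof.
  intros Hlin Hcont Hn.
  pose proof Kconst_pos as HK0. pose proof (mapnorm_pos H u n k Hn) as HM0.
  destruct (classic (is_finite Kconst /\ is_finite (mapnorm H n k u))) as [[HK HM]|Hinf].
  - unfold is_finite in HK, HM. symmetry in HK, HM.
    set (K := real Kconst) in *. set (M := real (mapnorm H n k u)) in *.
    destruct (domination H u Hlin Hcont n k Hn K M HK HM) as (phi1 & phi2 & Hs1 & Hs2 & Hd).
    exists phi1, phi2. split; [exact Hs1|]. split; [exact Hs2|]. intros x Hx.
    specialize (Hd x Hx).
    set (s := Re (phi1 (opmul (star x) x) + phi2 (opmul x (star x)))%C) in *. clearbody s.
    rewrite HK in HK0 |- *. rewrite HM in HM0 |- *. simpl in HK0, HM0.
    change (FH_norm H k (u x) <= sqrt K * M * sqrt s).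
    rewrite <- (sqrt_pow2 (FH_norm H k (u x))) by apply FH_norm_pos.
    apply Rle_trans with (sqrt (K * M ^ 2 * s)); [apply sqrt_le_1_alt; exact Hd|].
    rewrite sqrt_mult_alt by (apply Rmult_le_pos; [exact HK0|apply pow2_ge_0]).
    rewrite sqrt_mult_alt by exact HK0. rewrite sqrt_pow2 by exact HM0. lra.
  - destruct (faithful_states (2 * n + 1) ltac:(lia)) as (phi1 & phi2 & Hs1 & Hs2 & Hfaith).
    exists phi1, phi2. split; [exact Hs1|]. split; [exact Hs2|]. intros x Hx.
    assert (HsK : Rbar_le (Finite 0) (Rbar_sqrt Kconst)).
    { destruct Kconst; simpl; try tauto; try apply sqrt_pos; lra. }
    set (s := Re (phi1 (opmul (star x) x) + phi2 (opmul x (star x)))%C).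
    (* [Rbar_mult] sends 0 times infinity to 0, so an infinite factor helps only when the other
       factors are positive; should one of them vanish, then ||u x||_k = 0 as well. *)
    destruct (Req_dec (FH_norm H k (u x)) 0) as [H0|H0].
    { rewrite H0. apply Rbar_mult_pos; [apply Rbar_mult_pos; assumption|]. apply sqrt_pos. }
    assert (Hs : 0 < sqrt s).
    { apply sqrt_lt_R0. apply Rnot_le_lt. intros Hle. apply H0.
      rewrite (u_op_eq H u Hlin Hcont x opzero Hx in_S_opzero (Hfaith x Hx Hle)).
      rewrite (u_opzero H u Hlin). unfold FH_norm. rewrite ip_zero_l. apply sqrt_0. }
    assert (HKp : Rbar_lt (Finite 0) (Rbar_sqrt Kconst)).
    { destruct Kconst as [K| |] eqn:EK; simpl in *; [|exact I|contradiction].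
      apply sqrt_lt_R0. destruct (Rle_lt_or_eq_dec 0 K HK0) as [|<-]; [assumption|].
      exfalso. apply H0. apply Kconst_zero_u; assumption. }
    assert (HMp : Rbar_lt (Finite 0) (mapnorm H n k u)).
    { destruct (mapnorm H n k u) as [M| |] eqn:EM; simpl in *; [|exact I|contradiction].
      destruct (Rle_lt_or_eq_dec 0 M HM0) as [|<-]; [assumption|].
      exfalso. apply H0. pose proof (mapnorm_bound H u Hlin n k Hn 0 EM x Hx).
      pose proof (FH_norm_pos H k (u x)). lra. }
    assert (Einf : Rbar_mult (Rbar_sqrt Kconst) (mapnorm H n k u) = p_infty).
    { destruct Kconst as [K| |].
      - destruct (mapnorm H n k u) as [M| |].
        + exfalso. apply Hinf. split; reflexivity.
        + apply Rbar_mult_infty_r. exact HKp.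
        + destruct HMp.
      - apply Rbar_mult_infty_l. exact HMp.
      - destruct HK0. }
    rewrite Einf, Rbar_mult_infty_l by exact Hs. exact I.
Qed.
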